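(* Let $x>r>0$ and let $$D := \mathbb{C} \setminus \Big(\mathbb{R}\cap \bigcup_{n\in\mathbb{Z}} \{z\in\mathbb{C}: |z-nx|\leq r\}\Big),$$ i.e. the plane with the real line replaced by a ''dashed line'' of closed segments centred at the points $nx$, $n\in\mathbb{Z}$. Then $bh(D) = bh(\mathbb{H}) = 1/2$, where $\mathbb{H}$ is the upper half-plane. In particular, $bh(D)$ does not depend on $x$ or $r$.
   Context: Let $B_t$ be planar Brownian motion, and let $P_a, E_a$ denote probability and expectation when $B_0=a$. For a set $A\subseteq\mathbb{C}$ let $T(A)=\inf\{t\geq 0: B_t\notin A\}$ be the exit time of $A$. For a stopping time $\tau$ the Brownian–Hardy number is $bh(\tau)=\sup\{p>0: E_a[\tau^p]<\infty\}=\inf\{p>0:E_a[\tau^p]=\infty\}$, and for a set $D$ one writes $bh(D):=bh(T(D))$. For the exit times of domains considered here, finiteness of $E_a[T(D)^p]$ does not depend on the starting point $a\in D$ (Burkholder), so $bh(D)$ is well defined. *)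

(* Defs.v *)
From HB Require Import structures.
From mathcomp Require Import all_boot all_order all_algebra.
From mathcomp Require Import all_classical all_reals all_analysis.
Set Implicit Arguments. Unset Strict Implicit. Unset Printing Implicit Defensive.
Import Order.TTheory GRing.Theory Num.Theory.
Import numFieldNormedType.Exports.
Local Open Scope classical_set_scope.
Local Open Scope ring_scope.

(* Planar Brownian motion started at a, given by its two coordinate
   processes X (real part) and Y (imaginary part), on a probability space
   (Omega, P), for times t >= 0:
   - each X t, Y t is a random variable;
   - B_0 = a;
   - paths t |-> B_t(w) are continuous on [0, +oo);
   - for all 0 = t_0 < t_1 < ... < t_n and Borel sets A_i, C_i, the
     increments are independent, coordinates independent, each
     coordinate increment N(0, t_{i+1} - t_i):
       P(/\_i {X_{t_{i+1}} - X_{t_i} in A_i, Y_{t_{i+1}} - Y_{t_i} in C_i})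
         = prod_i N(0,t_{i+1}-t_i)(A_i) * N(0,t_{i+1}-t_i)(C_i). *)
Definition planar_BM {R : realType} {d : measure_display}
  {Omega : measurableType d} (P : probability Omega R) (a : R * R)
  (X Y : R -> Omega -> R) : Prop :=
  [/\ (forall t, measurable_fun setT (X t) /\ measurable_fun setT (Y t)),
      (forall w, X 0 w = a.1 /\ Y 0 w = a.2),
      (forall w, {within [set t : R | 0 <= t], continuous (fun t => X t w)} /\
                 {within [set t : R | 0 <= t], continuous (fun t => Y t w)}) &
      (forall (n : nat) (t : nat -> R) (A C : nat -> set R),
          t 0%N = 0 -> (forall i, (i < n)%N -> t i < t i.+1) ->
          (forall i, measurable (A i) /\ measurable (C i)) ->
          P (\bigcap_(i in [set k | (k < n)%N])
               [set w | A i (X (t i.+1) w - X (t i) w) /\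
                        C i (Y (t i.+1) w - Y (t i) w)])
          = (\prod_(i < n)
               (fine (normal_prob 0 (Num.sqrt (t i.+1 - t i)) (A i)) *
                fine (normal_prob 0 (Num.sqrt (t i.+1 - t i)) (C i))))%:E)].

(* Exit time T(D) = inf {t >= 0 : B_t not in D}, with inf of empty = +oo. *)
Definition exit_time {R : realType} {Omega : Type} (D : set (R * R))
  (X Y : R -> Omega -> R) (w : Omega) : \bar R :=
  ereal_inf [set t%:E | t in [set t : R | 0 <= t /\ ~ D (X t w, Y t w)]].

Definition bh {R : realType} {d : measure_display} {Omega : measurableType d}
  (P : probability Omega R) (tau : Omega -> \bar R) : \bar R :=
  ereal_sup [set p%:E | p in
    [set p : R | 0 < p /\ (\int[P]_w (poweR (tau w) p) < +oo)%E]].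

Definition dashed_domain {R : realType} (x r : R) : set (R * R) :=
  [set z | ~ (z.2 = 0 /\ exists n : int, `|z.1 - n%:~R * x| <= r)].

Definition upper_half_plane {R : realType} : set (R * R) := [set z | 0 < z.2].

(* Main.v *)
(* Lower bound: by Levy's maximal inequality, a Brownian coordinate stays above
   its starting point minus c up to time t with probability at least
   P(|N(0, t)| <= c), which is of order 1 / sqrt t; hence the p-th moment of the
   exit time is infinite for p > 1 / 2.  Starting in a gap of the dashed line,
   one first lets B move up while X stays in the gap.

   Upper bound: fix 1 / 2 < b < 1 and observe B at the times 2 k h.  Away from
   the real line |Y|^b has drift at most - e |Y|^(b - 2) (strict concavity).
   Close to it, with probability at least delta uniformly in the position, B
   crosses a dash during the next block; this pays for the bounded positive
   drift there.  So, with "alive" meaning that no crossing of this kind has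
   been seen, both E[|Y_k|^b; alive] and the total drift over k < n are
   bounded.  Splitting at height sqrt n gives P(alive at n) <= K / n^(b / 2),
   so that all moments of order p < b / 2 are finite; let b tend to 1.

   Only the Markov property at the points of a dyadic grid is used.  Path
   events are limits of grid events along refinements, with bounds uniform in
   the mesh. *)

Require Import Defs.
From HB Require Import structures.
From mathcomp Require Import all_boot all_order all_algebra.
From mathcomp Require Import all_classical all_reals all_analysis.
From mathcomp Require Import measurable_realfun.
From mathcomp Require Import ring lra zify.
Set Implicit Arguments. Unset Strict Implicit. Unset Printing Implicit Defensive.
Import Order.TTheory GRing.Theory Num.Theory.
Import numFieldNormedType.Exports.
Local Open Scope classical_set_scope.
Local Open Scope ring_scope.

(** * Power functions and densities *)

(** The vertical coordinate alone carries the upper bound: the dashes are periodic, so the chance of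
    hitting one has a lower bound uniform in X, and X itself need not be followed. The function
    |y|^b is concave on each half-line but has a cusp at 0, so it decreases on average only away
    from the line; this is why killing has to pay near it. Strict concavity, hence b < 1, is what
    leaves a drift, and the accumulated drift measures the time spent below a given height. The
    height sqrt n makes the two contributions of the same order.

    An exit time is an infimum over uncountably many times. It is therefore reached only through
    measurable events: one inside {tau >= t} for infinite moments, one containing {tau > t} for
    finite moments, with integrals compared by [le_integral_nonneg]. The events are built from
    closed conditions on grids, which are monotone under refinement and survive the limit by
    continuity of paths.

    The half-plane lies inside the dashed domain, so its exit time is the smaller one and inherits
    the finite moments. *)

Lemma powR_young {R : realType} (b t : R) : 1 / 2 < b -> b < 1 -> 0 <= t ->
  t `^ b <= (2 * b - 1) * t + 2 * (1 - b) * Num.sqrt t.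
Proof.
move=> b1 b2 t0.
have h1 : 0 < 2 * b - 1 by lra.
have h2 : 0 < 2 * (1 - b) by lra.
rewrite -powR12_sqrt//.
(* Young's inequality with weights 2b - 1 and 2(1 - b) interpolates [t^b] between [t] and [sqrt t].
   The strict concavity of [t^b] then follows from that of the square root, which is algebraic. *)
have E : t `^ b = t `^ (2 * b - 1) * t `^ (1 - b).
  rewrite -powRD; first by congr (_ `^ _); lra.
  by apply/implyP => /eqP; lra.
rewrite E.
apply: (le_trans (@conjugate_powR R (t `^ (2 * b - 1)) (t `^ (1 - b))
  (2 * b - 1)^-1 (2 * (1 - b))^-1 _ _ _ _ _)).
- exact: powR_ge0.
- exact: powR_ge0.
- by rewrite invr_gt0.
- by rewrite invr_gt0.
- by rewrite !invrK; lra.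
rewrite -!powRrM mulfV ?gt_eqF// powRr1// !invrK.
rewrite (_ : (1 - b) / (2 * (1 - b)) = 2^-1); first lra.
by field; lra.
Qed.

(** Square twice: the product of the roots is sqrt(1 - s^2) <= 1 - s^2/2, so the square of the sum
    is at most 4 - s^2 <= (2 - s^2/4)^2. *)
Lemma sqrt_add_sub_le {R : realType} (s : R) : `|s| <= 1 ->
  Num.sqrt (1 + s) + Num.sqrt (1 - s) <= 2 - s ^+ 2 / 4.
Proof.
rewrite ler_norml => /andP[s1 s2].
have s3 : s ^+ 2 <= 1 by nra.
set u := Num.sqrt (1 + s); set v := Num.sqrt (1 - s).
have u0 : 0 <= u := sqrtr_ge0 _.
have v0 : 0 <= v := sqrtr_ge0 _.
have uE : u ^+ 2 = 1 + s by rewrite sqr_sqrtr//; lra.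
have vE : v ^+ 2 = 1 - s by rewrite sqr_sqrtr//; lra.
have uv : u * v <= 1 - s ^+ 2 / 2.
  rewrite -(@ler_pXn2r _ 2)// ?nnegrE ?mulr_ge0//; last lra.
  rewrite exprMn uE vE; nra.
have uv0 : 0 <= u + v by lra.
have q0 : 0 <= 2 - s ^+ 2 / 4 by lra.
rewrite -(@ler_pXn2r _ 2)// ?nnegrE//.
rewrite sqrrD uE vE -mulr_natr; nra.
Qed.

(* Strict concavity of [t^b] at scale [s <= 1], crude growth for [s > 1]. *)
Lemma powR_second_difference {R : realType} (b s : R) : 1 / 2 < b -> b < 1 ->
  (`|1 + s| `^ b + `|1 - s| `^ b) / 2 <= 1 - (1 - b) / 4 * s ^+ 2 + 2 * s ^+ 4.
Proof.
move=> b1 b2.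
have [s1|s1] := lerP `|s| 1.
  have /andP[s2 s3] : - 1 <= s <= 1 by rewrite -ler_norml.
  rewrite !ger0_norm; [|lra..].
  have := @powR_young R b (1 + s) b1 b2.
  have := @powR_young R b (1 - s) b1 b2; have := sqrt_add_sub_le s1.
  set u := Num.sqrt (1 + s); set v := Num.sqrt (1 - s).
  move=> uv /(_ ltac:(lra)) h1 /(_ ltac:(lra)) h2.
  have s40 : 0 <= s ^+ 4 by rewrite exprn_even_ge0.
  nra.
have s0 : 0 < `|s| by lra.
have bnd e : `|e| = `|s| -> `|1 + e| `^ b <= 2 * `|s|.
  move=> ee; apply: (@le_trans _ _ ((2 * `|s|) `^ b)).
    have ee2 : `|1 + e| <= 2 * `|s|.
      by rewrite (le_trans (ler_normD _ _))// normr1 ee; lra.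
    by apply: ge0_ler_powR; rewrite ?nnegrE//; lra.
  by apply: ler1_powR; lra.
have h1 := bnd s erefl; have h2 := bnd (- s) (normrN _).
have q2 : s ^+ 2 = `|s| ^+ 2 by rewrite -normrX ger0_norm// exprn_even_ge0.
have q4 : s ^+ 4 = (`|s| ^+ 2) ^+ 2 by rewrite -q2 -exprM.
rewrite q4 q2.
set w := `|s| in s1 s0 h1 h2 *.
have w2 : w <= w ^+ 2 by nra.
have w4 : w ^+ 2 <= (w ^+ 2) ^+ 2 by nra.
nra.
Qed.

(** * Integration against a measure given by a density *)

Section density.
Local Open Scope ereal_scope.
Context d (T : measurableType d) (R : realType).
Variables (m nu : {measure set T -> \bar R}) (g : T -> R).
Hypotheses (mg : measurable_fun setT g) (g0 : forall x, (0 <= g x)%R).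
Hypothesis nuE : forall A, measurable A -> nu A = \int[m]_(x in A) (g x)%:E.

Import HBNNSimple.

Let density_nnsfun (f : {nnsfun T >-> R}) :
  \int[nu]_x (f x)%:E = \int[m]_x ((f x)%:E * (g x)%:E).
Proof.
under [LHS]eq_integral do rewrite fimfunE -fsumEFin//.
rewrite [LHS]ge0_integral_fsum//; last 2 first.
  - by move=> r; exact/measurable_EFinP/measurableT_comp.
  - by move=> n x _; rewrite EFinM nnfun_muleindic_ge0.
under [RHS]eq_integral.
  move=> x xD; rewrite fimfunE -fsumEFin// muleC ge0_mule_fsumr; last first.
    by move=> r; rewrite EFinM nnfun_muleindic_ge0.
  over.
rewrite [RHS]ge0_integral_fsum//; last 2 first.
  - move=> r; apply: emeasurable_funM; first exact/measurable_EFinP.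
    exact/measurable_EFinP/measurableT_comp.
  - move=> n x _; rewrite EFinM mule_ge0//; first by rewrite lee_fin.
    by rewrite nnfun_muleindic_ge0.
apply: eq_fsbigr => r rf.
have r0 : (0 <= r)%R by move: rf; rewrite inE => -[x _ <-].
under [RHS]eq_integral do rewrite EFinM muleCA.
rewrite integralZl_indic_nnsfun// integral_indic// setIT nuE; last first.
  exact: measurable_sfunP.
rewrite ge0_integralZl//=; last 2 first.
- apply: emeasurable_funM; first exact/measurable_EFinP.
  exact/measurable_EFinP/measurable_indic.
- by move=> x _; rewrite mule_ge0 ?lee_fin.
congr *%E; rewrite [LHS]integral_mkcond/=; apply: eq_integral => x _.
rewrite patchE indicE; case: ifPn => _; by rewrite ?mule1 ?mule0.
Qed.

Lemma ge0_integral_density (f : T -> \bar R) :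
  measurable_fun setT f -> (forall x, 0 <= f x) ->
  \int[nu]_x f x = \int[m]_x (f x * (g x)%:E).
Proof.
move=> mf f0.
pose f_ := nnsfun_approx measurableT mf.
transitivity (lim (\int[nu]_x (f_ n x)%:E @[n --> \oo])).
  rewrite -monotone_convergence//=.
  - apply: eq_integral => ? /[!inE] xD; apply/esym/cvg_lim => //=.
    exact: cvg_nnsfun_approx.
  - by move=> n; exact/measurable_EFinP/measurable_funTS.
  - by move=> n ? _; rewrite lee_fin.
  - by move=> ? _ ? ? mn; rewrite lee_fin; exact/lefP/nd_nnsfun_approx.
transitivity (lim (\int[m]_x ((f_ n x)%:E * (g x)%:E) @[n --> \oo])).
  by apply: congr_lim; apply/funext => n /=; exact: density_nnsfun.
rewrite -monotone_convergence//=.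
- apply: eq_integral => x _; apply/cvg_lim => //=.
  apply: cvgeZr => //; exact: cvg_nnsfun_approx.
- move=> n; apply: emeasurable_funM; last exact/measurable_EFinP.
  exact/measurable_EFinP/measurable_funTS.
- by move=> n ? _; rewrite mule_ge0 ?lee_fin.
- move=> ? _ ? ? mn; apply: lee_wpmul2r; first by rewrite lee_fin.
  by rewrite lee_fin; exact/lefP/nd_nnsfun_approx.
Qed.

End density.

(** * The centred normal law *)

Section normal.
Context {R : realType}.
Implicit Types (s : R).
Local Notation mu := (@lebesgue_measure R).

Lemma normal_pdf0E s (z : R) : s != 0 ->
  normal_pdf 0 s z = normal_peak s * expR (- z ^+ 2 / (s ^+ 2 *+ 2)).
Proof. by move=> s0; rewrite normal_pdfE// /normal_fun subr0. Qed.

(** Deviation 0 is a separate disjunct because the Gaussian formula [normal_pdf0E] requires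
    [s != 0]. *)
Lemma normal_pdfN s (z : R) : normal_pdf 0 s (- z) = normal_pdf 0 s z :> R \/ s = 0.
Proof.
have [->|s0] := eqVneq s 0; [by right|left].
by rewrite !normal_pdf0E// sqrrN.
Qed.

Lemma normal_probN s (A : set R) : s != 0 -> measurable A ->
  normal_prob 0 s (-%R @^-1` A) = normal_prob 0 s A.
Proof.
move=> s0 mA; rewrite /normal_prob.
transitivity (\int[pushforward mu (-%R : _ -> measurableTypeR R)]_(x in A)
    (normal_pdf 0 s x)%:E)%E; last first.
  by apply: eq_measure_integral => //= B mB _; exact: lebesgue_measureN.
rewrite ge0_integral_pushforward.
- by apply: eq_integral => z _ /=; have [->|/eqP] := normal_pdfN s z;
    rewrite ?(negbTE s0).
- exact: oppr_measurable.
- exact: mA.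
- by apply/measurable_EFinP/measurable_funTS; exact: measurable_normal_pdf.
- by move=> z _; rewrite lee_fin normal_pdf_ge0.
Qed.

Lemma integral_normalN s (f : R -> \bar R) : s != 0 ->
  measurable_fun setT f -> (forall x, 0 <= f x)%E ->
  (\int[normal_prob 0 s]_z f (- z)%R = \int[normal_prob 0 s]_z f z)%E.
Proof.
move=> s0 mf f0.
transitivity (\int[pushforward (normal_prob 0 s)
   (-%R : measurableTypeR R -> measurableTypeR R)]_z f z)%E; last first.
  by apply: eq_measure_integral => /= A mA _; exact: normal_probN.
rewrite ge0_integral_pushforward; [by rewrite preimage_setT| |by []|exact: mf|].
  exact: oppr_measurable.
by move=> z _; exact: f0.
Qed.

(** On [-K, K] the density is smallest at the ends. The bound depends on the interval only through
    its length, which later makes the crossing probability uniform in the position. *)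
Lemma normal_prob_itv_ge s (K a b : R) : s != 0 ->
  - K <= a -> a <= b -> b <= K ->
  (((b - a) * normal_pdf 0 s K)%:E <= normal_prob 0 s `[a, b])%E.
Proof.
move=> s0 Ka ab bK.
have pK : 0 <= normal_pdf 0 s K by exact: normal_pdf_ge0.
have -> : ((b - a) * normal_pdf 0 s K)%:E =
    (\int[mu]_(x in `[a, b]) (normal_pdf 0 s K)%:E)%E.
  rewrite integral_cst//= lebesgue_measure_itv/= lte_fin.
  move: ab; rewrite le_eqVlt => /predU1P[->|->].
    by rewrite subrr mul0r ltxx mule0.
  by rewrite -EFinD -EFinM mulrC.
apply: ge0_le_integral => //=.
- by apply/measurable_EFinP/measurable_funTS; exact: measurable_normal_pdf.
- move=> z; rewrite in_itv/= => /andP[az zb]; rewrite lee_fin.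
  rewrite !normal_pdf0E// ler_wpM2l ?normal_peak_ge0//.
  rewrite ler_expR ler_wpM2r ?invr_ge0 ?mulrn_wge0 ?sqr_ge0// lerN2; nra.
Qed.

Lemma normal_prob_itv_gt0 s (a b : R) : s != 0 -> a < b ->
  (0 < normal_prob 0 s `[a, b])%E.
Proof.
move=> s0 ab; apply: lt_le_trans (normal_prob_itv_ge s0 (K := `|a| + `|b|) _ (ltW ab) _).
- rewrite lte_fin mulr_gt0 ?subr_gt0// normal_pdf0E// mulr_gt0 ?expR_gt0//.
  exact: normal_peak_gt0.
- by have := ler_norm (- a); rewrite normrN; have := normr_ge0 b; lra.
- by have := ler_norm b; have := normr_ge0 a; lra.
Qed.

Lemma normal_peak_double s : normal_peak (2 * s) = normal_peak s / 2.
Proof.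
have sqrt4 (q : R) : Num.sqrt (2 ^+ 2 * q) = 2 * Num.sqrt q.
  by rewrite sqrtrM ?sqr_ge0// sqrtr_sqr ger0_norm.
(* [p] is later unified with [pi], through the unfolding of [normal_peak]. *)
have E (p : R) : (Num.sqrt ((2 * s) ^+ 2 * p *+ 2))^-1 = (Num.sqrt (s ^+ 2 * p *+ 2))^-1 / 2.
  have -> : (2 * s) ^+ 2 * p *+ 2 = 2 ^+ 2 * (s ^+ 2 * p *+ 2).
    rewrite -(mulr_natr (s ^+ 2 * p)) -(mulr_natr ((2 * s) ^+ 2 * p)).
    ring.
  rewrite sqrt4.
  rewrite invfM.
  exact: mulrC.
exact: E.
Qed.

(* Gaussian tails absorb [z^4] at the price of doubling the deviation. *)
Lemma pow4_normal_pdf s (z : R) : 0 < s ->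
  z ^+ 4 * normal_pdf 0 s z <= 512 * s ^+ 4 * normal_pdf 0 (2 * s) z.
Proof.
move=> s0.
have s2 : 2 * s != 0 by rewrite gt_eqF//; lra.
have s1 : s != 0 by rewrite gt_eqF.
rewrite !normal_pdf0E//.
have peak2 := normal_peak_double s.
rewrite peak2.
(* [v] is the exponent at deviation 2s; at deviation s the exponent is 4v, and z^4 = 64 s^4 v^2.
   Hence 512 = 2 * 64 * 4, with 2 from the ratio of the peaks and 4 from v^2 exp(-v) <= 4. *)
set v := z ^+ 2 / (8 * s ^+ 2).
have v0 : 0 <= v by apply: divr_ge0; [exact: sqr_ge0|apply: mulr_ge0 => //; exact: sqr_ge0].
have -> : - z ^+ 2 / (s ^+ 2 *+ 2) = - v + - v + (- v - v).
  by rewrite /v -mulr_natr; field; rewrite gt_eqF.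
have -> : - z ^+ 2 / ((2 * s) ^+ 2 *+ 2) = - v.
  by rewrite /v -mulr_natr; field; rewrite gt_eqF.
have -> : z ^+ 4 = 64 * s ^+ 4 * v ^+ 2 by rewrite /v; field; rewrite gt_eqF.
have p0 := normal_peak_ge0 s.
have s40 : 0 <= s ^+ 4 by rewrite exprn_ge0// ltW.
suff : v ^+ 2 * expR (- v + - v + (- v - v)) <= 4 * expR (- v).
  move=> h; have := ler_wpM2l (mulr_ge0 s40 p0) h; lra.
rewrite !expRD.
have e0 : 0 < expR (- v) by exact: expR_gt0.
have e1 : expR (- v) <= 1 by rewrite -expR0 ler_expR; lra.
have ve : v ^+ 2 * expR (- v) <= 4.
  have h := expR_ge1Dx (v / 2).
  rewrite expRN ler_pdivrMr ?expR_gt0//.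
  have -> : expR v = expR (v / 2) ^+ 2 by rewrite expr2 -expRD; congr expR; lra.
  nra.
set e := expR (- v) in e0 e1 ve *.
have : e * e <= 1 by nra.
move=> ee; have := ler_wpM2l (ltW e0) ve.
have := mulr_ge0 (ltW e0) (sqr_ge0 v); nra.
Qed.

Lemma normal_moment4 s : 0 < s ->
  (\int[normal_prob 0 s]_z (z ^+ 4)%:E <= (512 * s ^+ 4)%:E)%E.
Proof.
move=> s0; have m4 (t : R) : 0 <= t ^+ 4 by rewrite exprn_even_ge0.
have mX4 : measurable_fun setT (fun t : R => t ^+ 4) by exact: measurable_funX.
rewrite (@ge0_integral_density _ _ _ mu _ (normal_pdf 0 s))//; first last.
- exact/measurable_EFinP.
- by move=> t; exact: normal_pdf_ge0.
- exact: measurable_normal_pdf.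
rewrite (_ : (512 * s ^+ 4)%:E =
  (\int[mu]_z ((512 * s ^+ 4)%:E * (normal_pdf 0 (2 * s) z)%:E))%E).
- apply: ge0_le_integral => //=.
  + by move=> t _; rewrite -EFinM lee_fin; apply: mulr_ge0 => //; exact: normal_pdf_ge0.
  + apply/measurable_EFinP/measurable_funM => //; exact: measurable_normal_pdf.
  + apply/measurable_EFinP/measurable_funM => //; exact: measurable_normal_pdf.
  + by move=> t _; rewrite -!EFinM lee_fin pow4_normal_pdf.
- rewrite ge0_integralZl.
  + by rewrite integral_normal_pdf mule1.
  + exact: measurableT.
  + by apply/measurable_EFinP; exact: measurable_normal_pdf.
  + by move=> t _; rewrite lee_fin normal_pdf_ge0.
  + by rewrite lee_fin; apply: mulr_ge0; [exact: ler0n|apply: exprn_ge0; exact: ltW].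
Qed.

(** Markov's inequality for the fourth power. *)
Lemma normal_tail s (c : R) : 0 < s -> 0 < c ->
  (normal_prob 0 s [set z : R | c < `|z|]%R <= (512 * s ^+ 4 / c ^+ 4)%:E)%E.
Proof.
move=> s0 c0.
have mc : measurable [set z : R | c < `|z|].
  rewrite (_ : [set _ | _] = ~` `[- c, c]%classic); first exact: measurableC.
  by apply/seteqP; split => z /=; rewrite in_itv/= -ler_norml ltNge => /negP.
have c40 : 0 < c ^+ 4 by rewrite exprn_gt0.
apply: (@le_trans _ _ (\int[normal_prob 0 s]_z ((c ^+ 4)^-1%:E * (z ^+ 4)%:E))%E).
  have -> : normal_prob 0 s [set z : R | c < `|z|]%R =
      (\int[normal_prob 0 s]_z (\1_[set z : R | c < `|z|]%R z)%:E)%E.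
    by rewrite integral_indic// setIT.
  apply: ge0_le_integral => //.
  - exact/measurable_EFinP/measurable_indic.
  - by apply/measurable_EFinP/measurable_funM => //; exact: measurable_funX.
  - move=> z _; rewrite -EFinM lee_fin indicE.
    case: (boolP (z \in _)); rewrite ?inE/= => cz; last first.
      by rewrite mulr_ge0 ?invr_ge0 ?exprn_even_ge0// ltW.
    rewrite mulrC ler_pdivlMr// mul1r.
    have -> : z ^+ 4 = `|z| ^+ 4 by rewrite -normrX ger0_norm// exprn_even_ge0.
    by rewrite lerXn2r ?nnegrE// ltW.
rewrite ge0_integralZl.
- rewrite mulrC EFinM lee_pmul2l ?lte_fin ?invr_gt0//; exact: normal_moment4.
- exact: measurableT.
- by apply/measurable_EFinP; exact: measurable_funX.
- by move=> z _; rewrite lee_fin exprn_even_ge0.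
- by rewrite lee_fin invr_ge0 ltW.
Qed.

End normal.

(** * The Lyapunov function |y|^b under a Gaussian step *)

Section lyapunov.
Context {R : realType}.
Implicit Types s : R.

(** Away from the line this is the guaranteed mean decrease of |y|^b in one step. The value 1 in the
    band [|y| < M] is a charge, not a decrease: it makes the total drift count visits to the band as
    well, as [drift_split] requires. *)
Definition drift (M e b y : R) : R := if `|y| < M then 1 else e * `|y| `^ (b - 2).

Lemma drift_ge0 (M e b y : R) : 0 <= e -> 0 <= drift M e b y.
Proof. by move=> e0; rewrite /drift; case: ifP => // _; rewrite mulr_ge0 ?powR_ge0. Qed.

Lemma measurable_normr_powR (b : R) : measurable_fun setT (fun y : R => `|y| `^ b).
Proof. by apply: measurableT_comp (measurable_powR _) _; exact: normr_measurable. Qed.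

Lemma measurable_drift (M e b : R) : measurable_fun setT (drift M e b).
Proof.
rewrite /drift; apply: measurable_fun_ifT => //.
- by apply: measurable_fun_ltr => //; exact: normr_measurable.
- by apply: measurable_funM => //; exact: measurable_normr_powR.
Qed.

(* Splitting at height [L]: far away the height counts, close by the drift does. *)
Lemma drift_split (M e b L y : R) : 1 <= M -> M <= L -> 0 < e -> e <= 1 -> 0 < b -> b < 1 ->
  1 <= `|y| `^ b / L `^ b + drift M e b y * (L `^ (2 - b) / e).
Proof.
move=> M1 ML e0 e1 b0 b1.
have L0 : 0 < L by lra.
have Lb : 0 < L `^ b by exact: powR_gt0.
have L2b : 1 <= L `^ (2 - b).
  by rewrite -[leLHS](powRr0 L); apply: ler_powR; lra.
have L2be : 1 <= L `^ (2 - b) / e by rewrite ler_pdivlMr// mul1r; lra.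
have d0 : 0 <= drift M e b y by apply: drift_ge0; exact: ltW.
have [Ly|yL] := lerP L `|y|.
  have h : 1 <= `|y| `^ b / L `^ b.
    rewrite ler_pdivlMr// mul1r; apply: ge0_ler_powR => //; rewrite ?nnegrE//; lra.
  by apply: (le_trans h); rewrite lerDl mulr_ge0// (le_trans _ L2be).
apply: (@le_trans _ _ (drift M e b y * (L `^ (2 - b) / e))); last first.
  by rewrite lerDr divr_ge0 ?powR_ge0.
rewrite /drift; case: ifPn => [_|]; first by rewrite mul1r.
rewrite -leNgt => My; have y0 : 0 < `|y| by lra.
have -> : b - 2 = - (2 - b) by lra.
have p0 : 0 < `|y| `^ (2 - b) by exact: powR_gt0.
rewrite powRN (_ : _ * _ = L `^ (2 - b) / `|y| `^ (2 - b)); last first.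
  by field; rewrite !gt_eqF.
rewrite ler_pdivlMr// mul1r.
by apply: ge0_ler_powR; rewrite ?nnegrE//; lra.
Qed.

Lemma integral_normal_cst s (c : R) : (\int[normal_prob 0 s]_z c%:E = c%:E)%E.
Proof.
transitivity (c%:E * normal_prob 0 s setT)%E.
  exact: (integral_cst (normal_prob 0 s) measurableT c%:E).
have -> : normal_prob 0 s setT = 1%E := @probability_setT _ _ _ (normal_prob 0 s).
by rewrite mule1.
Qed.

(** Finite because z^2 <= 1 + z^4, positive because [1, 2] has positive mass; the exact value does
    not matter. *)
Lemma normal_moment2 s : 0 < s ->
  exists v : R, 0 < v /\ (\int[normal_prob 0 s]_z (z ^+ 2)%:E = v%:E)%E.
Proof.
move=> s1; have s0 : s != 0 by rewrite gt_eqF.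
have m2 : measurable_fun setT (fun t : R => (t ^+ 2)%:E).
  by apply/measurable_EFinP; exact: measurable_funX.
have m4 : measurable_fun setT (fun t : R => (t ^+ 4)%:E).
  by apply/measurable_EFinP; exact: measurable_funX.
set I := (\int[_]_z _)%E.
have Ioo : (I < +oo)%E.
  apply: (@le_lt_trans _ _ (1%:E + (512 * s ^+ 4)%:E)%E); last by rewrite -EFinD ltry.
  apply: (@le_trans _ _ (\int[normal_prob 0 s]_z (1%:E + (z ^+ 4)%:E))%E).
    apply: ge0_le_integral => //.
    - by move=> z _; rewrite lee_fin sqr_ge0.
    - exact: emeasurable_funD.
    - move=> z _; rewrite -EFinD lee_fin (_ : z ^+ 4 = (z ^+ 2) ^+ 2) -?exprM//.
      have := sqr_ge0 (z ^+ 2 - 1); have := sqr_ge0 (z ^+ 2); nra.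
  rewrite ge0_integralD//.
  - rewrite integral_normal_cst leeD2l//; exact: normal_moment4.
  - by move=> z _; rewrite lee_fin exprn_even_ge0.
have I0 : (0 < I)%E.
  apply: (@lt_le_trans _ _ (normal_prob 0 s `[1, 2])).
    by apply: normal_prob_itv_gt0 => //; lra.
  have -> : normal_prob 0 s `[1, 2] =
      (\int[normal_prob 0 s]_z (\1_(`[1, 2]%classic : set R) z)%:E)%E.
    by rewrite integral_indic// setIT.
  apply: ge0_le_integral => //.
  - exact/measurable_EFinP/measurable_indic.
  - move=> z _; rewrite lee_fin indicE; case: (boolP (z \in _)); last by rewrite sqr_ge0.
    by rewrite inE/= in_itv/= => /andP[z1 z2]; nra.
exists (fine I); split; first by rewrite fine_gt0// I0.
by rewrite fineK// ge0_fin_numE// ltW.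
Qed.

(** By symmetry of z, the mean of |y + z|^b is that of the half-sum over both signs, and
    [powR_second_difference] applies with s = z / y. The second moment yields a gain of order |y|^(b
    - 2), the fourth an error smaller by a factor y^2. *)
Lemma normal_lyapunov s (b : R) : 0 < s -> 1 / 2 < b -> b < 1 ->
  exists M e B : R, [/\ 1 <= M, 0 < e, e <= 1, 0 <= B & forall y : R,
    (\int[normal_prob 0 s]_z (`|y + z| `^ b)%:E + (drift M e b y)%:E
     <= (`|y| `^ b)%:E + B%:E * (\1_[set t : R | `|t| < M] y)%:E)%E].
Proof.
move=> s0 b1 b2.
have s1 : s != 0 by rewrite gt_eqF.
have [v2 [v20 V2]] := normal_moment2 s0.
have [v4 [v40 V4]] : exists v4 : R, 0 < v4 /\
    (\int[normal_prob 0 s]_z (z ^+ 4)%:E <= v4%:E)%E.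
  exists (512 * s ^+ 4); split; last exact: normal_moment4.
  by apply: mulr_gt0; [exact: ltr0n|exact: exprn_gt0].
have [k [kE k0]] : exists k : R, k = (1 - b) / 4 /\ 0 < k.
  by exists ((1 - b) / 4); split => //; lra.
(* For |y| >= M also y^2 >= M >= 4 v4 / (k v2), so the error 2 v4 / y^2 is at most half of the gain
   k v2; the other half becomes [e]. *)
pose M := 1 + 4 * v4 / (k * v2).
have kv : 0 < k * v2 by rewrite mulr_gt0.
have M1 : 1 <= M by rewrite /M lerDl; apply: divr_ge0; [lra|exact: ltW].
pose e := Num.min 1 (k * v2 / 2).
have e0 : 0 < e by rewrite /e lt_min; apply/andP; split; lra.
have e1 : e <= 1 by rewrite /e ge_min lexx.
have mf y : measurable_fun setT (fun z : R => (`|y + z| `^ b)%:E).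
  apply/measurable_EFinP; apply: measurableT_comp (measurable_normr_powR b) _.
  exact: measurable_funD.
have m2 : measurable_fun setT (fun t : R => (t ^+ 2)%:E).
  by apply/measurable_EFinP; exact: measurable_funX.
have m4 : measurable_fun setT (fun t : R => (t ^+ 4)%:E).
  by apply/measurable_EFinP; exact: measurable_funX.
have p4 (z : R) : 0 <= z ^+ 4 by rewrite exprn_even_ge0.
(* In the band, |y + z|^b <= 1 + |y + z| <= M + 2 + z^4, and the drift adds 1. *)
exists M, e, (M + 3 + v4); split => //; first by lra.
move=> y; set I := (\int[_]_z _)%E.
have I0 : (0 <= I)%E by apply: integral_ge0 => z _; rewrite lee_fin powR_ge0.
rewrite /drift indicE; case: ifPn => yM.
  rewrite mem_set// mule1 -EFinD.
  apply: (@le_trans _ _ ((M + 2 + v4)%:E + 1%:E)%E); last first.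
    by rewrite -EFinD lee_fin; have := powR_ge0 `|y| b; lra.
  rewrite leeD2r//.
  apply: (@le_trans _ _ (\int[normal_prob 0 s]_z ((M + 2)%:E + (z ^+ 4)%:E))%E).
    apply: ge0_le_integral => //.
    - exact: mf.
    - exact: emeasurable_funD.
    - move=> z _; rewrite -EFinD lee_fin.
      apply: (@le_trans _ _ (1 + `|y + z|)).
        have [h|h] := lerP 1 `|y + z|.
          by apply: (le_trans (ler1_powR h (ltW b2))); lra.
        apply: (@le_trans _ _ 1); last by rewrite lerDl.
        apply: (@le_trans _ _ (1 `^ b)); last by rewrite powR1.
        by apply: ge0_ler_powR; rewrite ?nnegrE//; lra.
      have h1 := ler_normD y z.
      have -> : z ^+ 4 = `|z| ^+ 4 by rewrite -normrX ger0_norm.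
      have h2 : `|z| <= 1 + `|z| ^+ 4.
        rewrite (_ : `|z| ^+ 4 = (`|z| ^+ 2) ^+ 2) -?exprM//.
        have := sqr_ge0 (`|z| - 1); have := sqr_ge0 (`|z| ^+ 2 - 1).
        have := normr_ge0 z; nra.
      lra.
  rewrite ge0_integralD//.
  - rewrite integral_normal_cst (EFinD (M + 2)) leeD2l//.
  - by move=> z _; rewrite lee_fin; lra.
  - by move=> z _; rewrite lee_fin.
rewrite memNset ?mule0 ?adde0//; last exact/negP.
move: yM; rewrite -leNgt => My.
have y0 : 0 < `|y| by lra.
have yn0 : y != 0 by rewrite -normr_gt0.
set w := `|y| `^ (b - 2).
have w0 : 0 < w by exact: powR_gt0.
have y2 : y ^+ 2 = `|y| ^+ 2 by rewrite -normrX ger0_norm ?sqr_ge0.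
have yb : `|y| `^ b = w * y ^+ 2.
  rewrite y2 -(powR_mulrn 2) ?normr_ge0// /w -powRD; first by congr (_ `^ _); lra.
  by apply/implyP => _; rewrite gt_eqF.
have IN : (\int[normal_prob 0 s]_z (`|y - z| `^ b)%:E = I)%E.
  by apply: (integral_normalN s1 (mf y)) => z; rewrite lee_fin powR_ge0.
(* The second difference at z / y, multiplied by 2 |y|^b = 2 w y^2. *)
have pt z : `|y + z| `^ b + `|y - z| `^ b + 2 * w * k * z ^+ 2 <=
    2 * w * y ^+ 2 + 4 * w / y ^+ 2 * z ^+ 4.
  have -> : y + z = y * (1 + z / y) by field.
  have -> : y - z = y * (1 - z / y) by field.
  rewrite !normrM !powRM ?normr_ge0// yb.
  have h := powR_second_difference (z / y) b1 b2; rewrite -kE in h.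
  have q : 0 < 2 * (w * y ^+ 2) by rewrite y2; rewrite !mulr_gt0 ?exprn_gt0.
  have := ler_wpM2l (ltW q) h.
  have -> : 2 * (w * y ^+ 2) * (1 - k * (z / y) ^+ 2 + 2 * (z / y) ^+ 4) =
    2 * w * y ^+ 2 - 2 * w * k * z ^+ 2 + 4 * w / y ^+ 2 * z ^+ 4 by field.
  lra.
have key : (I + I + (2 * w * k * v2)%:E <=
    (2 * w * y ^+ 2 + 4 * w / y ^+ 2 * v4)%:E)%E.
  have c1 : 0 <= 2 * w * k by rewrite !mulr_ge0 ?ltW.
  have c2 : 0 <= 4 * w / y ^+ 2 by apply: divr_ge0; [lra|exact: sqr_ge0].
  have c3 : 0 <= 2 * w * y ^+ 2 by apply: mulr_ge0; [lra|exact: sqr_ge0].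
  have mfN : measurable_fun setT (fun z : R => (`|y - z| `^ b)%:E).
    apply/measurable_EFinP; apply: measurableT_comp (measurable_normr_powR b) _.
    exact: measurable_funB.
  have n1 (z : R) : setT z -> (0 <= (`|y + z| `^ b)%:E)%E by rewrite lee_fin powR_ge0.
  have n2 (z : R) : setT z -> (0 <= (`|y - z| `^ b)%:E)%E by rewrite lee_fin powR_ge0.
  have n3 (z : R) : setT z -> (0 <= (z ^+ 2)%:E)%E by move=> _; rewrite lee_fin; exact: sqr_ge0.
  have n4 (z : R) : setT z -> (0 <= (z ^+ 4)%:E)%E by rewrite lee_fin p4.
  have c1e : (0 <= (2 * w * k)%:E)%E by rewrite lee_fin.
  have c2e : (0 <= (4 * w / y ^+ 2)%:E)%E by rewrite lee_fin.
  have c3e (z : R) : setT z -> (0 <= (2 * w * y ^+ 2)%:E)%E by rewrite lee_fin.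
  have m12 := emeasurable_funD (mf y) mfN.
  have m3 : measurable_fun setT (fun z : R => ((2 * w * k)%:E * (z ^+ 2)%:E)%E).
    by apply: emeasurable_funM m2; exact: measurable_cst.
  have m5 : measurable_fun setT (fun z : R => ((4 * w / y ^+ 2)%:E * (z ^+ 4)%:E)%E).
    by apply: emeasurable_funM m4; exact: measurable_cst.
  have n12 (z : R) (Tz : setT z) := adde_ge0 (n1 z Tz) (n2 z Tz).
  have n3' (z : R) (Tz : setT z) := mule_ge0 c1e (n3 z Tz).
  have n5 (z : R) (Tz : setT z) := mule_ge0 c2e (n4 z Tz).
  have E1 := ge0_integralD (normal_prob 0 s) measurableT n12 m12 n3' m3.
  have E2 := ge0_integralD (normal_prob 0 s) measurableT n1 (mf y) n2 mfN.
  have E3 := ge0_integralZl (normal_prob 0 s) measurableT m2 n3 c1e.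
  have E4 := ge0_integralD (normal_prob 0 s) measurableT c3e (measurable_cst _) n5 m5.
  have E5 := ge0_integralZl (normal_prob 0 s) measurableT m4 n4 c2e.
  rewrite E2 IN E3 V2 in E1; rewrite E5 integral_normal_cst in E4.
  rewrite EFinM -E1.
  apply: (@le_trans _ _ (\int[normal_prob 0 s]_z ((2 * w * y ^+ 2)%:E +
      (4 * w / y ^+ 2)%:E * (z ^+ 4)%:E))%E); last first.
    rewrite E4 EFinD leeD2l// (EFinM (4 * w / y ^+ 2)).
    exact: lee_wpmul2l.
  apply: ge0_le_integral; first exact: measurableT.
  - by move=> z Tz; apply: adde_ge0; [exact: n12|exact: n3'].
  - by apply: emeasurable_funD; [exact: m12|exact: m3].
  - by apply: emeasurable_funD; [exact: measurable_cst|exact: m5].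
  - by move=> z _; rewrite -!EFinM -!EFinD lee_fin; exact: pt.
have Ifin : I \is a fin_num.
  rewrite ge0_fin_numE//; apply: le_lt_trans (ltry _); apply: le_trans key.
  rewrite -addeA leeDl// adde_ge0// lee_fin !mulr_ge0 ?ltW//.
move: key; rewrite -(fineK Ifin) -!EFinD !lee_fin => key.
have h1 : 2 * v4 / y ^+ 2 <= k * v2 / 2.
  have : 4 * v4 / (k * v2) <= y ^+ 2.
    apply: (@le_trans _ _ M); first by rewrite /M; lra.
    by rewrite y2; nra.
  rewrite ler_pdivrMr// => h.
  rewrite ler_pdivrMr; last by rewrite y2 exprn_gt0.
  lra.
have h2 : e <= k * v2 / 2 by rewrite /e ge_min lexx orbT.
have h3 := ler_wpM2l (ltW w0) h1; have h4 := ler_wpM2l (ltW w0) h2.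
rewrite yb; lra.
Qed.

End lyapunov.

(** * Independence *)

Section independence.
Context d (T : measurableType d) (R : realType) (P : probability T R).
Implicit Types (G H : set (set T)) (E F : set T).

(** Real-valued, so that linear arithmetic applies; [prE] leads back to the measure. *)
Definition pr E : R := fine (P E).

Lemma prE E : measurable E -> P E = (pr E)%:E.
Proof. by move=> mE; rewrite fineK// fin_num_measure. Qed.

Lemma pr_ge0 E : 0 <= pr E. Proof. exact: fine_ge0. Qed.

Lemma pr_le E F : measurable E -> measurable F -> E `<=` F -> pr E <= pr F.
Proof. by move=> mE mF EF; rewrite -lee_fin -!prE// le_measure ?inE. Qed.

Lemma pr_le1 E : measurable E -> pr E <= 1.
Proof. by move=> mE; rewrite -lee_fin -prE// probability_le1. Qed.

Lemma prT : pr setT = 1. Proof. by rewrite /pr probability_setT. Qed.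

Lemma prU E F : measurable E -> measurable F -> E `&` F = set0 ->
  pr (E `|` F) = pr E + pr F.
Proof.
move=> mE mF EF; apply: EFin_inj; rewrite EFinD -!prE//; last exact: measurableU.
by rewrite measureU.
Qed.

Lemma prU_le E F : measurable E -> measurable F -> pr (E `|` F) <= pr E + pr F.
Proof.
move=> mE mF; rewrite -lee_fin EFinD -!prE//; last exact: measurableU.
exact: measureU2.
Qed.

Lemma prC E : measurable E -> pr (~` E) = 1 - pr E.
Proof.
move=> mE; have := prU mE (measurableC mE) (setICr E).
by rewrite setUv prT => ->; rewrite addrAC subrr add0r.
Qed.

Definition independent_systems G H :=
  forall E F, G E -> H F -> pr (E `&` F) = pr E * pr F.

Lemma independent_systems_sym G H :
  independent_systems G H -> independent_systems H G.
Proof. by move=> GH E F HE GF; rewrite setIC mulrC; exact: GH. Qed.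

Let sigma_measurable G : G `<=` measurable -> <<s G >> `<=` measurable.
Proof. by move=> Gm; apply: smallest_sub => //; exact: sigma_algebra_measurable. Qed.

(** For a fixed F the events independent of it form a lambda-system, so Dynkin's theorem extends
    independence from a pi-system to the sigma-algebra it generates. *)
Lemma independent_sigma_l G H : setI_closed G -> G `<=` measurable ->
  H `<=` measurable -> independent_systems G H -> independent_systems <<s G >> H.
Proof.
move=> GI Gm Hm GH E F sE HF; have mF := Hm _ HF.
pose L := [set E | measurable E /\ pr (E `&` F) = pr E * pr F].
suff : <<s G >> `<=` L by move=> /(_ _ sE)[].
apply: lambda_system_subset => //; last first.
  by move=> A GA; split; [exact: Gm|exact: GH].
apply/dynkin_lambda_system; split.
- by split => //; rewrite setTI prT mul1r.
- move=> A [mA hA]; split; first exact: measurableC.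
  have : pr F = pr (A `&` F) + pr (~` A `&` F).
    rewrite -prU; [|exact: measurableI|by apply: measurableI => //; exact: measurableC|].
      by rewrite -setIUl setUv setTI.
    by rewrite setIACA setICr set0I.
  by rewrite hA prC// => h; lra.
- move=> A tA hA; have mA n : measurable (A n) by case: (hA n).
  have mU : measurable (\bigcup_n A n) by exact: bigcup_measurable.
  split=> //; apply: EFin_inj; rewrite EFinM -!prE//; last exact: measurableI.
  rewrite setI_bigcupl measure_semi_bigcup; first last.
  - by rewrite -setI_bigcupl; exact: measurableI.
  - apply/trivIsetP => i j _ _ ij; rewrite setIACA.
    by move/trivIsetP : tA => /(_ i j I I ij) ->; rewrite set0I.
  - by move=> n; exact: measurableI.
  rewrite measure_semi_bigcup// muleC (prE mF) -nneseriesZl//.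
  apply: eq_eseriesr => n _.
  rewrite [LHS](prE (measurableI _ _ (mA n) mF)) [X in (_ * X)%E](prE (mA n)).
  by case: (hA n) => _ ->; rewrite EFinM muleC.
Qed.

Lemma independent_sigma G H : setI_closed G -> setI_closed H ->
  G `<=` measurable -> H `<=` measurable ->
  independent_systems G H -> independent_systems <<s G >> <<s H >>.
Proof.
move=> GI HI Gm Hm GH; apply: independent_sigma_l => //; first exact: sigma_measurable.
apply: independent_systems_sym; apply: independent_sigma_l => //.
exact: independent_systems_sym.
Qed.

Section fubini.
Variables (G H : set (set T)).
Hypotheses (Gm : <<s G >> `<=` measurable) (Hm : <<s H >> `<=` measurable).
Hypothesis GH : independent_systems <<s G >> <<s H >>.
Context d1 d2 (T1 : measurableType d1) (T2 : measurableType d2).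
Variables (U : T -> T1) (W : T -> T2).
Hypothesis mU : measurable_fun setT (U : g_sigma_algebraType G -> T1).
Hypothesis mW : measurable_fun setT (W : g_sigma_algebraType H -> T2).

(** The joint law of U and W is a product, and Tonelli integrates W out with U frozen. The Markov
    property is used in this form: U depends on the past, W on later increments. *)
Lemma independent_fubini (g : T1 * T2 -> \bar R) :
  measurable_fun setT g -> (forall z, 0 <= g z)%E ->
  (\int[P]_w g (U w, W w) = \int[P]_w \int[P]_v g (U w, W v))%E.
Proof.
move=> mg g0.
have mU' : measurable_fun setT U.
  by move=> _ B mB; apply: Gm; exact: (mU measurableT mB).
have mW' : measurable_fun setT W.
  by move=> _ B mB; apply: Hm; exact: (mW measurableT mB).
have mUW : measurable_fun setT (fun w => (U w, W w)) by exact/measurable_fun_pair.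
pose U1 : {mfun T >-> T1} := HB.pack U (isMeasurableFun.Build _ _ _ _ _ mU').
pose W1 : {mfun T >-> T2} := HB.pack W (isMeasurableFun.Build _ _ _ _ _ mW').
pose UW1 : {mfun T >-> (T1 * T2)%type} :=
  HB.pack (fun w => (U w, W w)) (isMeasurableFun.Build _ _ _ _ _ mUW).
pose m1 : probability T1 R := distribution P U1.
pose m2 : probability T2 R := distribution P W1.
pose m : probability _ R := distribution P UW1.
transitivity (\int[m]_z g z)%E.
  by rewrite ge0_integral_distribution.
transitivity (\int[m1 \x m2]_z g z)%E.
  apply: eq_measure_integral => /= A mA _; apply/esym.
  apply: product_measure_unique => // B C mB mC.
  have sU : <<s G >> (U @^-1` B) by have := mU measurableT mB; rewrite setTI.
  have sW : <<s H >> (W @^-1` C) by have := mW measurableT mC; rewrite setTI.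
  change (P (U @^-1` B `&` W @^-1` C) = (P (U @^-1` B) * P (W @^-1` C))%E).
  have mB' := Gm sU; have mC' := Hm sW.
  by rewrite (prE (measurableI _ _ mB' mC')) (prE mB') (prE mC') (GH sU sW) EFinM.
rewrite fubini_tonelli1//.
transitivity (\int[P]_w \int[m2]_y g (U w, y))%E.
  rewrite /m1 ge0_integral_distribution//.
  - exact: measurable_fun_fubini_tonelli_F.
  - by move=> x; apply: integral_ge0.
apply: eq_integral => w _; rewrite /m2 ge0_integral_distribution//.
by apply: measurableT_comp mg _; exact: pair1_measurable.
Qed.

End fubini.

End independence.

(** * Brownian increments on a grid *)

Section brownian_grid.
Context {R : realType} {d : measure_display} {T : measurableType d}.
Context (P : probability T R) (a : R * R) (X Y : R -> T -> R).

Definition increment (Z : R -> T -> R) (h : R) (i : nat) (w : T) : R :=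
  Z (i.+1%:R * h) w - Z (i%:R * h) w.

Definition cylinder (h : R) (N : nat) (A C : nat -> set R) : set T :=
  \bigcap_(i in [set k | (k < N)%N])
    [set w | A i (increment X h i w) /\ C i (increment Y h i w)].

(* Events on the [X]-increments of index in [I] and [Y]-increments of index in [J]. *)
Definition cylinders (h : R) (N : nat) (I J : set nat) : set (set T) :=
  [set E | exists A C : nat -> set R,
    [/\ forall i, measurable (A i) /\ measurable (C i),
        forall i, ~ I i -> A i = setT,
        forall i, ~ J i -> C i = setT & E = cylinder h N A C]].

(** The sample space carrying only the events of the chosen increments. As a type of its own it
    turns measurability with respect to the past into an ordinary [measurable_fun] statement. *)
Definition gridT (h : R) (N : nat) (I J : set nat) : Type :=
  g_sigma_algebraType (cylinders h N I J).

Hypothesis BM : planar_BM P a X Y.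

Lemma BM_measurable t : measurable_fun setT (X t) /\ measurable_fun setT (Y t).
Proof. by case: BM. Qed.

(* [G] hides the integral behind the normal law from conversion. *)
Let BM_law : exists G : R -> set R -> R,
  [/\ forall u B, G u B = fine (normal_prob 0 u B), forall u, G u setT = 1 &
    forall (n : nat) (t : nat -> R) (A C : nat -> set R),
      t 0%N = 0 -> (forall i, (i < n)%N -> t i < t i.+1) ->
      (forall i, measurable (A i) /\ measurable (C i)) ->
      pr P (\bigcap_(i in [set k | (k < n)%N])
        [set w | A i (X (t i.+1) w - X (t i) w) /\ C i (Y (t i.+1) w - Y (t i) w)])
      = \prod_(i < n) (G (Num.sqrt (t i.+1 - t i)) (A i) *
                       G (Num.sqrt (t i.+1 - t i)) (C i))].
Proof.
exists (fun u B => fine (normal_prob 0 u B)); split => //.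
  move=> u; rewrite (_ : normal_prob 0 u setT = 1%E)//.
  exact: (@probability_setT _ _ _ (normal_prob 0 u)).
by move=> n t A C t0 tl mAC; have [_ _ _ law] := BM; rewrite /pr law.
Qed.

(** The finite-dimensional law starts at time 0. For s > 0 it is used on 0 < s < t with no condition
    on the first increment; for s = 0 the partition has one step, since its times must increase
    strictly. *)
Lemma BM_increment_law (s t : R) (A C : set R) : 0 <= s -> s < t ->
  measurable A -> measurable C ->
  pr P [set w | A (X t w - X s w) /\ C (Y t w - Y s w)] =
  fine (normal_prob 0 (Num.sqrt (t - s)) A) * fine (normal_prob 0 (Num.sqrt (t - s)) C).
Proof.
move=> s0 st mA mC; have [G [GE GT law]] := BM_law; rewrite -!GE.
have [s00|s1] := eqVneq s 0.
  have tl i : (i < 1)%N -> i%:R * t < i.+1%:R * t.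
    by rewrite ltnS leqn0 => /eqP ->; rewrite mul0r mul1r; lra.
  have := law 1%N (fun i => i%:R * t) (fun=> A) (fun=> C) (mul0r _) tl (fun=> conj mA mC).
  rewrite big_ord1 mul0r mul1r => E; rewrite s00.
  set S := [set w | _]; rewrite (_ : S = \bigcap_(i in [set k | (k < 1)%N])
    [set w | A (X (i.+1%:R * t) w - X (i%:R * t) w) /\
      C (Y (i.+1%:R * t) w - Y (i%:R * t) w)]) ?E//.
  apply/seteqP; split => w /=; rewrite /S /=.
    by move=> H i; rewrite /= ltnS leqn0 => /eqP ->; rewrite mul0r mul1r.
  by move=> /(_ 0%N erefl); rewrite mul0r mul1r.
pose tt (i : nat) : R := if i is j.+1 then (if j is 0%N then s else t) else 0.
pose sel (B : set R) (i : nat) : set R := if i is 0%N then setT else B.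
have tl i : (i < 2)%N -> tt i < tt i.+1.
  by case: i => [|[|i]]//= _; rewrite lt_neqAle s0 eq_sym s1.
have ms i : measurable (sel A i) /\ measurable (sel C i).
  by case: i => [|i]; split => /=; [exact: measurableT|exact: measurableT| |].
have gT (B : set R) u : G u (sel B 0%N) = 1 by exact: GT.
have prod2 (F : nat -> R) : \prod_(i < 2) F i = F 0%N * F 1%N.
  by rewrite big_ord_recr big_ord1.
have := law 2%N tt (sel A) (sel C) erefl tl ms.
rewrite (prod2 (fun i => G (Num.sqrt (tt i.+1 - tt i)) (sel A i) *
  G (Num.sqrt (tt i.+1 - tt i)) (sel C i))) !gT !mul1r => E.
set S := [set w | _]; rewrite (_ : S = \bigcap_(i in [set k | (k < 2)%N])
  [set w | sel A i (X (tt i.+1) w - X (tt i) w) /\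
    sel C i (Y (tt i.+1) w - Y (tt i) w)]) ?E//.
apply/seteqP; split => w /=; rewrite /S /=.
  by move=> H [|[|i]].
by move=> /(_ 1%N erefl).
Qed.

Variables (h : R) (N : nat).
Hypothesis h0 : 0 < h.

Lemma measurable_increment i :
  measurable_fun setT (increment X h i) /\ measurable_fun setT (increment Y h i).
Proof.
by split; apply: measurable_funB; have [? ?] := BM_measurable (i%:R * h);
  have [? ?] := BM_measurable (i.+1%:R * h).
Qed.

Lemma measurable_cylinder (A C : nat -> set R) :
  (forall i, measurable (A i) /\ measurable (C i)) -> measurable (cylinder h N A C).
Proof.
move=> mAC; rewrite /cylinder bigcap_mkcond; apply: bigcapT_measurable => i.
case: ifP => // _.
have [mA mC] := mAC i; have [mX mY] := measurable_increment i.
have := measurableI _ _ (mX measurableT _ mA) (mY measurableT _ mC).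
by rewrite !setTI.
Qed.

Let pr_cylinder : exists g : set R -> R, g setT = 1 /\
  forall A C, (forall i, measurable (A i) /\ measurable (C i)) ->
  pr P (cylinder h N A C) = \prod_(i < N) (g (A i) * g (C i)).
Proof.
have [G [_ GT law]] := BM_law; exists (G (Num.sqrt h)); split => // A C mAC.
have st i : i.+1%:R * h - i%:R * h = h by rewrite -mulrBl -natrB// subSnn mul1r.
have tl i : (i < N)%N -> i%:R * h < i.+1%:R * h by rewrite -subr_gt0 st.
have := law N (fun i => i%:R * h) A C (mul0r _) tl mAC => E.
rewrite /cylinder /increment E.
by apply: eq_bigr => i _; rewrite st.
Qed.

Lemma cylinders_measurable I J : cylinders h N I J `<=` measurable.
Proof. by move=> _ [A [C [mAC _ _ ->]]]; exact: measurable_cylinder. Qed.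

Let cylinderI (A C A' C' : nat -> set R) :
  cylinder h N A C `&` cylinder h N A' C' =
  cylinder h N (fun i => A i `&` A' i) (fun i => C i `&` C' i).
Proof.
apply/seteqP; split => w.
  by move=> [E E'] i Ni; have [? ?] := E i Ni; have [? ?] := E' i Ni.
by move=> E; split => i Ni; have [[? ?] [? ?]] := E i Ni.
Qed.

Lemma setI_closed_cylinders I J : setI_closed (cylinders h N I J).
Proof.
move=> _ _ [A [C [mAC AI CJ ->]]] [A' [C' [mAC' AI' CJ' ->]]].
exists (fun i => A i `&` A' i), (fun i => C i `&` C' i); split.
- by move=> i; have [? ?] := mAC i; have [? ?] := mAC' i; split; exact: measurableI.
- by move=> i ni; rewrite AI// AI'// setIT.
- by move=> i ni; rewrite CJ// CJ'// setIT.
- exact: cylinderI.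
Qed.

(** Cylinders form a pi-system, and for each coordinate and index at most one of the two cylinders
    imposes a condition, so the product formula splits. Separate index sets for X and Y give
    independence in time and independence of the coordinates at once. *)
Lemma independent_grid I J I' J' : I `&` I' = set0 -> J `&` J' = set0 ->
  independent_systems P <<s cylinders h N I J >> <<s cylinders h N I' J' >>.
Proof.
move=> II' JJ'; apply: independent_sigma; try exact: setI_closed_cylinders;
  try exact: cylinders_measurable.
move=> _ _ [A [C [mAC AI CJ ->]]] [A' [C' [mAC' AI' CJ' ->]]].
have [g [gT cylE]] := pr_cylinder.
have gI (K K' : set nat) (B B' : nat -> set R) i : K `&` K' = set0 ->
    (forall i, ~ K i -> B i = setT) -> (forall i, ~ K' i -> B' i = setT) ->
    g (B i `&` B' i) = g (B i) * g (B' i).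
  move=> KK' BK BK'; have [Ki|/BK ->] := pselect (K i); last by rewrite setTI gT mul1r.
  rewrite (BK' i) ?setIT ?gT ?mulr1// => K'i.
  by have : (K `&` K') i by []; rewrite KK'.
rewrite cylinderI !cylE//; last first.
  by move=> i; have [? ?] := mAC i; have [? ?] := mAC' i; split; exact: measurableI.
rewrite -big_split/=; apply: eq_bigr => i _.
by rewrite (gI I I')// (gI J J')// mulrACA.
Qed.

Lemma gridT_measurable I J E : <<s cylinders h N I J >> E -> measurable E.
Proof.
apply: smallest_sub; [exact: sigma_algebra_measurable|exact: cylinders_measurable].
Qed.

Lemma measurable_increment_gridX (I J : set nat) i : (i < N)%N -> I i ->
  measurable_fun setT (increment X h i : gridT h N I J -> R).
Proof.
move=> iN Ii _ B mB; rewrite setTI; apply: sub_sigma_algebra.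
exists (fun j => if j == i then B else setT), (fun=> setT); split => //.
- by move=> j; case: ifP.
- by move=> j; case: eqP => // ->.
- apply/seteqP; split => w /=; first by move=> Bw j _; case: eqP => // ->.
  by move=> /(_ i iN)/=; rewrite eqxx => -[].
Qed.

Lemma measurable_increment_gridY (I J : set nat) i : (i < N)%N -> J i ->
  measurable_fun setT (increment Y h i : gridT h N I J -> R).
Proof.
move=> iN Ii _ B mB; rewrite setTI; apply: sub_sigma_algebra.
exists (fun=> setT), (fun j => if j == i then B else setT); split => //.
- by move=> j; case: ifP.
- by move=> j; case: eqP => // ->.
- apply/seteqP; split => w /=; first by move=> Bw j _; case: eqP => // ->.
  by move=> /(_ i iN)/=; rewrite eqxx => -[].
Qed.

Let measurable_diff (Z : R -> T -> R) I J (K : set nat) j k :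
  (forall i, (i < N)%N -> K i ->
    measurable_fun setT (increment Z h i : gridT h N I J -> R)) ->
  (j <= k)%N -> (k <= N)%N -> (forall i, (j <= i)%N -> (i < k)%N -> K i) ->
  measurable_fun setT
    ((fun w => Z (k%:R * h) w - Z (j%:R * h) w) : gridT h N I J -> R).
Proof.
move=> mZ jk; rewrite -(subnKC jk); elim: (k - j)%N => [|n IH] kN Kk.
  rewrite addn0 (_ : (fun _ => _) = cst 0)//.
  by apply/funext => w; rewrite subrr.
rewrite addnS in kN Kk *.
rewrite (_ : (fun _ => _) = (fun w => (Z ((j + n)%:R * h) w - Z (j%:R * h) w) +
    increment Z h (j + n) w)); last first.
  by apply/funext => w; rewrite /increment; ring.
apply: measurable_funD.
  by apply: IH => [|i ji ik]; [exact: ltnW|apply: Kk => //; exact: ltnW].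
by apply: mZ => //; apply: Kk => //; exact: leq_addr.
Qed.

Lemma measurable_diff_gridX I J j k :
  (j <= k)%N -> (k <= N)%N -> (forall i, (j <= i)%N -> (i < k)%N -> I i) ->
  measurable_fun setT
    ((fun w => X (k%:R * h) w - X (j%:R * h) w) : gridT h N I J -> R).
Proof. by apply: measurable_diff => i; exact: measurable_increment_gridX. Qed.

Lemma measurable_diff_gridY I J j k :
  (j <= k)%N -> (k <= N)%N -> (forall i, (j <= i)%N -> (i < k)%N -> J i) ->
  measurable_fun setT
    ((fun w => Y (k%:R * h) w - Y (j%:R * h) w) : gridT h N I J -> R).
Proof. by apply: measurable_diff => i; exact: measurable_increment_gridY. Qed.

Lemma measurable_gridX I J k :
  (k <= N)%N -> (forall i, (i < k)%N -> I i) ->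
  measurable_fun setT (X (k%:R * h) : gridT h N I J -> R).
Proof.
move=> kN kI; have [_ B0 _ _] := BM.
rewrite (_ : X _ = (fun w => a.1 + (X (k%:R * h) w - X (0%:R * h) w))).
  by apply: measurable_funD => //; apply: measurable_diff_gridX => // i _; exact: kI.
by apply/funext => w; rewrite mul0r; have [-> _] := B0 w; rewrite addrC subrK.
Qed.

Lemma measurable_gridY I J k :
  (k <= N)%N -> (forall i, (i < k)%N -> J i) ->
  measurable_fun setT (Y (k%:R * h) : gridT h N I J -> R).
Proof.
move=> kN kI; have [_ B0 _ _] := BM.
rewrite (_ : Y _ = (fun w => a.2 + (Y (k%:R * h) w - Y (0%:R * h) w))).
  by apply: measurable_funD => //; apply: measurable_diff_gridY => // i _; exact: kI.
by apply/funext => w; rewrite mul0r; have [_ ->] := B0 w; rewrite addrC subrK.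
Qed.

End brownian_grid.

(** * Levy's maximal inequality *)

Lemma measurable_gtc {R : realType} {d} {T : measurableType d} (f : T -> R) (c : R) :
  measurable_fun setT f -> measurable [set w | c < f w].
Proof.
move=> mf; rewrite (_ : [set _ | _] = setT `&` f @^-1` `]c, +oo[%classic); first exact: mf.
by rewrite setTI; apply/seteqP; split => w /=; rewrite in_itv/= andbT.
Qed.

Lemma measurable_lec {R : realType} {d} {T : measurableType d} (f : T -> R) (c : R) :
  measurable_fun setT f -> measurable [set w | f w <= c].
Proof.
move=> mf; rewrite (_ : [set _ | _] = setT `&` f @^-1` `]-oo, c]%classic); first exact: mf.
by rewrite setTI; apply/seteqP; split => w /=; rewrite in_itv.
Qed.

Lemma measurable_gec {R : realType} {d} {T : measurableType d} (f : T -> R) (c : R) :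
  measurable_fun setT f -> measurable [set w | c <= f w].
Proof.
move=> mf; rewrite (_ : [set _ | _] = setT `&` f @^-1` `[c, +oo[%classic); first exact: mf.
by rewrite setTI; apply/seteqP; split => w /=; rewrite in_itv/= andbT.
Qed.

Lemma measurable_forall_lt {d} {T : measurableType d} (n : nat) (E : nat -> set T) :
  (forall i, (i < n)%N -> measurable (E i)) ->
  measurable [set w | forall i, (i < n)%N -> E i w].
Proof.
move=> mE; rewrite (_ : [set _ | _] = \bigcap_(i in [set k | (k < n)%N]) E i)//.
rewrite bigcap_mkcond; apply: bigcapT_measurable => i.
by case: ifP => //; rewrite inE; exact: mE.
Qed.

Section normal_symmetry.
Context {R : realType} (s : R) (s0 : s != 0).
Local Notation g := (normal_prob 0 s).

Lemma pr_normalN (A : set R) : measurable A -> pr g (-%R @^-1` A) = pr g A.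
Proof. by move=> mA; congr fine; exact: normal_probN. Qed.

(** The set and its reflection cover the line and have equal mass. The signs e = 1 and e = -1 serve
    upward and downward passages. *)
Lemma normal_half (e : R) : 1 / 2 <= pr g [set z : R | 0 <= e * z].
Proof.
have mA : measurable [set z : R | 0 <= e * z].
  by apply: measurable_gec; exact: measurable_funM.
have mA' : measurable (-%R @^-1` [set z : R | 0 <= e * z]).
  by rewrite -[X in measurable X]setTI; exact: oppr_measurable.
have := prU_le g mA mA'; rewrite (pr_normalN mA).
suff -> : [set z : R | 0 <= e * z] `|` -%R @^-1` [set z : R | 0 <= e * z] = setT.
  by rewrite prT; lra.
apply/seteqP; split => // z _ /=; rewrite mulrN.
by have [h|h] := lerP 0 (e * z); [left|right; lra].
Qed.

Lemma normal_tail_sym (c : R) : 0 <= c ->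
  pr g [set z : R | c < `|z|] = 2 * pr g [set z : R | c < z].
Proof.
move=> c0; have mA : measurable [set z : R | c < z] by exact: measurable_gtc.
have mA' : measurable (-%R @^-1` [set z : R | c < z]).
  by rewrite -[X in measurable X]setTI; exact: oppr_measurable.
rewrite (_ : [set z : R | c < `|z|] = [set z : R | c < z] `|` -%R @^-1` [set z : R | c < z]).
  rewrite (prU g mA mA') ?pr_normalN//; first lra.
  by apply/seteqP; split => // z [] /=; lra.
apply/seteqP; split => z /=; rewrite ltrNr.
  have [z0|z0] := lerP 0 z; first by rewrite ger0_norm//; left.
  by rewrite ltr0_norm// ltrNr; right.
case=> h; first by rewrite (lt_le_trans h)// ler_norm.
by rewrite (@lt_le_trans _ _ (- z)) 1?ltrNr// -normrN ler_norm.
Qed.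

End normal_symmetry.

Section levy.
Context {R : realType} {d : measure_display} {T : measurableType d}.
Context (P : probability T R).

(** The events F, that c is first exceeded at index i, are disjoint. If on each of them the path
    ends no lower with conditional probability at least 1/2, it ends above c on at least half of
    their union. The induction adds one F at a time. *)
Lemma levy_first_passage (S : nat -> T -> R) (n : nat) (c : R) :
  (forall i, (i <= n)%N -> measurable_fun setT (S i)) ->
  (forall i, (i <= n)%N ->
    let F := [set w | c < S i w /\ forall l, (l < i)%N -> S l w <= c] in
    pr P F <= 2 * pr P (F `&` [set w | S i w <= S n w])) ->
  pr P [set w | exists2 i, (i < n.+1)%N & c < S i w] <= 2 * pr P [set w | c < S n w].
Proof.
move=> mS FS.
pose U k := [set w | exists2 i, (i < k)%N & c < S i w].
pose F i := [set w | c < S i w /\ forall l, (l < i)%N -> S l w <= c].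
have mV : measurable [set w | c < S n w] by apply: measurable_gtc; exact: mS.
have mF i : (i <= n)%N -> measurable (F i).
  move=> i_n; rewrite (_ : F i = [set w | c < S i w] `&`
    [set w | forall l, (l < i)%N -> S l w <= c]) //.
  apply: measurableI; first by apply: measurable_gtc; exact: mS.
  apply: (@measurable_forall_lt _ _ i (fun l => [set w | S l w <= c])) => l li.
  by apply: measurable_lec; apply: mS; exact: leq_trans (ltnW li) i_n.
have US k : U k.+1 = U k `|` F k.
  apply/seteqP; split => w /=.
    move=> [i ik ci]; have [[l lk cl]|no] := pselect (U k w); first by left; exists l.
    have ki : i = k.
      apply/eqP; rewrite eqn_leq -ltnS ik /= leqNgt; apply/negP => ik'.
      by apply: no; exists i.
    right; rewrite -ki; split => // l li; rewrite leNgt; apply/negP => cl.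
    by apply: no; exists l => //; rewrite -ki.
  move=> [[i ik ci]|[ck _]]; first by exists i => //; exact: ltnW.
  by exists k.
have UF k : U k `&` F k = set0.
  apply/seteqP; split => // w [[i ik ci] [_ /(_ i ik)]].
  by rewrite leNgt ci.
have mU k : (k <= n.+1)%N -> measurable (U k).
  elim: k => [_|k IH kn]; last by rewrite US; apply: measurableU; [exact/IH/ltnW|exact: mF].
  by rewrite (_ : U 0%N = set0)//; apply/seteqP; split => // w [].
suff H k : (k <= n.+1)%N -> pr P (U k) <= 2 * pr P (U k `&` [set w | c < S n w]).
  apply: (le_trans (H n.+1 (leqnn _))); rewrite ler_wpM2l// pr_le//.
  by apply: measurableI => //; exact: mU.
elim: k => [_|k IH kn].
  by rewrite (_ : U 0%N = set0) ?set0I /pr ?measure0 ?mulr0//; apply/seteqP; split => // w [].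
have kn' : (k <= n.+1)%N by exact: ltnW.
have mUk := mU _ kn'; have mFk := mF _ kn.
rewrite US prU// setIUl prU; [|exact: measurableI|exact: measurableI|]; last first.
  by rewrite setIACA UF set0I.
have h1 := IH kn'; have h2 := FS k kn; rewrite -/(F k) /= in h2.
have : pr P (F k `&` [set w | S k w <= S n w]) <= pr P (F k `&` [set w | c < S n w]).
  apply: pr_le.
  - apply: measurableI => //.
    rewrite (_ : [set _ | _] = [set w | 0 <= S n w - S k w]).
      by apply: measurable_gec; apply: measurable_funB; exact: mS.
    by apply/seteqP; split => w /=; rewrite subr_ge0.
  - exact: measurableI.
  - by move=> w [[ck cl] /= kS]; split => //=; exact: lt_le_trans kS.
lra.
Qed.

(** * Levy's inequality for one coordinate, with [G j k] for the increments between [j] and [k] *)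

Section grid.
Variables (Z : R -> T -> R) (h : R) (N : nat) (h0 : 0 < h).
Variable (G : nat -> nat -> set (set T)).
Hypothesis mG : forall j k i l, (k <= N)%N -> (j <= i)%N -> (i <= l)%N -> (l <= k)%N ->
  measurable_fun setT
    ((fun w => Z (l%:R * h) w - Z (i%:R * h) w) : g_sigma_algebraType (G j k) -> R).
Hypothesis Gm : forall j k, <<s G j k >> `<=` measurable.
Hypothesis GI : forall i j k, independent_systems P <<s G i j >> <<s G j k >>.
Hypothesis law : forall (s t : R) (B : set R), 0 <= s -> s < t -> measurable B ->
  pr P [set w | B (Z t w - Z s w)] = pr (normal_prob 0 (Num.sqrt (t - s))) B.

Let mZ i l : (i <= l)%N -> (l <= N)%N ->
  measurable_fun setT (fun w => Z (l%:R * h) w - Z (i%:R * h) w).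
Proof.
by move=> il lN _ B mB; apply: (Gm (j := i) (k := l)); apply: mG.
Qed.

(** A first passage at i is an event of the increments up to [j + i]; the remaining increment is
    independent of it and symmetric. *)
Lemma levy_grid (e c : R) (j n : nat) : 0 <= c -> (0 < n)%N -> (j + n <= N)%N ->
  pr P [set w | exists2 i, (i < n.+1)%N &
    c < e * (Z ((j + i)%:R * h) w - Z (j%:R * h) w)]
  <= 2 * pr (normal_prob 0 (Num.sqrt (n%:R * h))) [set z | c < e * z].
Proof.
move=> c0 n0 jnN.
pose S i w := e * (Z ((j + i)%:R * h) w - Z (j%:R * h) w).
have mS i : (i <= n)%N -> measurable_fun setT (S i).
  move=> i_n; apply: measurable_funM => //; apply: mZ; first exact: leq_addr.
  by apply: leq_trans jnN; rewrite leq_add2l.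
have -> : pr (normal_prob 0 (Num.sqrt (n%:R * h))) [set z | c < e * z] =
    pr P [set w | c < S n w].
  have := @law (j%:R * h) ((j + n)%:R * h) [set z | c < e * z].
  rewrite -mulrBl -natrB ?leq_addr// addKn => -> //.
  - by rewrite mulr_ge0// ltW.
  - by rewrite ltr_pM2r// ltr_nat -{1}(addn0 j) ltn_add2l.
  - by apply: measurable_gtc; exact: measurable_funM.
apply: (levy_first_passage mS) => i i_n /=.
set F := [set w | _]; set V := [set w | _].
have ijN : (j + i <= N)%N by apply: leq_trans jnN; rewrite leq_add2l.
have mSG l : (l <= i)%N -> measurable_fun setT (S l : g_sigma_algebraType (G j (j + i)) -> R).
  move=> li; apply: measurable_funM => //; apply: mG => //; first exact: leq_addr.
  by rewrite leq_add2l.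
have sF : <<s G j (j + i) >> F.
  rewrite (_ : F = [set w | c < S i w] `&` [set w | forall l, (l < i)%N -> S l w <= c]) //.
  apply: (@measurableI _ (g_sigma_algebraType (G j (j + i)))).
    by apply: measurable_gtc; exact: mSG.
  apply: (@measurable_forall_lt _ (g_sigma_algebraType (G j (j + i))) i
    (fun l => [set w | S l w <= c])) => l li.
  by apply: measurable_lec; apply: mSG; exact: ltnW.
have VE : V = [set w | 0 <= e * (Z ((j + n)%:R * h) w - Z ((j + i)%:R * h) w)].
  by apply/seteqP; split => w; rewrite /V /S /=; lra.
have sV : <<s G (j + i) (j + n) >> V.
  rewrite VE; apply: (@measurable_gec R _ (g_sigma_algebraType (G (j + i) (j + n)))).
  by apply: measurable_funM => //; apply: mG => //; rewrite leq_add2l.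
rewrite (GI sF sV).
suff V2 : 1 / 2 <= pr P V by have := pr_ge0 P F; nra.
(* At i = n the remaining increment is 0 and [law], which requires s < t, does not apply. *)
move: i_n; rewrite leq_eqVlt => /predU1P[ii|i_n].
  rewrite (_ : V = setT) ?prT; first lra.
  by rewrite VE ii; apply/seteqP; split => // w _ /=; rewrite subrr mulr0.
rewrite VE; have := @law ((j + i)%:R * h) ((j + n)%:R * h) [set z | 0 <= e * z].
rewrite /= => ->.
- apply: normal_half; rewrite gt_eqF// sqrtr_gt0 -mulrBl mulr_gt0// subr_gt0 ltr_nat.
  by rewrite ltn_add2l.
- by rewrite mulr_ge0// ltW.
- by rewrite ltr_pM2r// ltr_nat ltn_add2l.
- by apply: measurable_gec; exact: measurable_funM.
Qed.

Let n_sqrt n : (0 < n)%N -> Num.sqrt (n%:R * h) != 0.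
Proof. by move=> n0; rewrite gt_eqF// sqrtr_gt0 mulr_gt0// ltr0n. Qed.

(** Falling below -c has probability at most 2 P(N > c) = P(|N| > c). Only the total time n h
    enters, so the bound is uniform in the mesh. *)
Lemma pr_grid_above (c : R) (j n : nat) : 0 <= c -> (0 < n)%N -> (j + n <= N)%N ->
  pr (normal_prob 0 (Num.sqrt (n%:R * h))) `[- c, c] <=
  pr P [set w | forall i, (i < n.+1)%N -> - c <= Z ((j + i)%:R * h) w - Z (j%:R * h) w].
Proof.
move=> c0 n0 jnN.
set E := [set w : T | _].
have mE : measurable E.
  apply: (@measurable_forall_lt _ _ n.+1 (fun i =>
    [set w | - c <= Z ((j + i)%:R * h) w - Z (j%:R * h) w])) => i i_n.
  apply: measurable_gec; apply: mZ; first exact: leq_addr.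
  by apply: leq_trans jnN; rewrite leq_add2l.
have := levy_grid (- 1) c0 n0 jnN.
set U := [set w : T | _]; set g := normal_prob _ _.
have -> : U = ~` E.
  apply/seteqP; split => w; rewrite /U /E /=.
    by move=> [i i_n ci] /(_ i i_n); lra.
  move/existsNP => [i /not_implyP[i_n /negP]]; rewrite -ltNge => ci; exists i => //; lra.
rewrite prC// => hU.
have mc : measurable [set z : R | c < `|z|] by apply: measurable_gtc; exact: normr_measurable.
have -> : `[- c, c]%classic = ~` [set z : R | c < `|z|].
  by apply/seteqP; split => z /=; rewrite in_itv/= -ler_norml leNgt => /negP.
rewrite prC// normal_tail_sym ?n_sqrt//.
suff : pr g [set z | c < -1 * z] = pr g [set z | c < z] by lra.
rewrite /g -(pr_normalN (n_sqrt n0) (measurable_gtc c (@measurable_id _ _ setT))).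
by congr pr; apply/seteqP; split => z /=; rewrite mulN1r.
Qed.

(** Each direction costs at most P(|N| > c) <= 512 (n h)^2 / c^4, and there are two. *)
Lemma pr_grid_within (c : R) (j n : nat) : 0 < c -> (0 < n)%N -> (j + n <= N)%N ->
  1 - 1024 * (n%:R * h) ^+ 2 / c ^+ 4 <=
  pr P [set w | forall i, (i < n.+1)%N -> `|Z ((j + i)%:R * h) w - Z (j%:R * h) w| <= c].
Proof.
move=> c0 n0 jnN.
have mZc i : (i < n.+1)%N -> measurable_fun setT (fun w => Z ((j + i)%:R * h) w - Z (j%:R * h) w).
  move=> i_n; apply: mZ; first exact: leq_addr.
  by apply: leq_trans jnN; rewrite leq_add2l.
set E := [set w : T | _].
have mE : measurable E.
  apply: (@measurable_forall_lt _ _ n.+1 (fun i =>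
    [set w | `|Z ((j + i)%:R * h) w - Z (j%:R * h) w| <= c])) => i i_n.
  apply: measurable_lec; apply: measurableT_comp; first exact: normr_measurable.
  exact: mZc.
pose U e := [set w | exists2 i, (i < n.+1)%N &
    c < e * (Z ((j + i)%:R * h) w - Z (j%:R * h) w)].
have mU e : measurable (U e).
  rewrite (_ : U e = ~` [set w | forall i, (i < n.+1)%N ->
      e * (Z ((j + i)%:R * h) w - Z (j%:R * h) w) <= c]).
    apply: measurableC; apply: (@measurable_forall_lt _ _ n.+1 (fun i =>
      [set w | e * (Z ((j + i)%:R * h) w - Z (j%:R * h) w) <= c])) => i i_n.
    by apply: measurable_lec; apply: measurable_funM => //; exact: mZc.
  apply/seteqP; split => w; rewrite /U /=.
    by move=> [i i_n ci] /(_ i i_n); lra.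
  by move/existsNP => [i /not_implyP[i_n /negP]]; rewrite -ltNge => ci; exists i.
have h1 := levy_grid 1 (ltW c0) n0 jnN; have h2 := levy_grid (- 1) (ltW c0) n0 jnN.
rewrite -!/(U _) in h1 h2.
have EU : ~` E = U 1 `|` U (- 1).
  apply/seteqP; split => w; rewrite /U /E /=.
    move/existsNP => [i /not_implyP[i_n /negP]]; rewrite -ltNge => ci.
    have [z0|z0] := lerP 0 (Z ((j + i)%:R * h) w - Z (j%:R * h) w).
      by left; exists i => //; move: ci; rewrite ger0_norm// mul1r.
    by right; exists i => //; move: ci; rewrite ltr0_norm// mulN1r.
  move=> [] [i i_n ci] /(_ i i_n); rewrite ler_norml => /andP[]; lra.
have := prU_le P (mU 1) (mU (- 1)); rewrite -EU prC// => h3.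
have s0 : 0 < Num.sqrt (n%:R * h) by rewrite lt_neqAle eq_sym n_sqrt// sqrtr_ge0.
have := normal_tail s0 c0.
have mc : measurable [set z : R | c < `|z|] by apply: measurable_gtc; exact: normr_measurable.
rewrite (prE (normal_prob 0 (Num.sqrt (n%:R * h))) mc) lee_fin normal_tail_sym ?n_sqrt//; last exact: ltW.
have -> : Num.sqrt (n%:R * h) ^+ 4 = (n%:R * h) ^+ 2.
  rewrite (_ : 4 = 2 * 2)%N // exprM sqr_sqrtr //.
  by apply: mulr_ge0 => //; exact: ltW.
move: h1 h2; set g := normal_prob _ _ => h1 h2.
have e1 : pr g [set z | c < 1 * z] = pr g [set z | c < z].
  by congr pr; apply/seteqP; split => z /=; rewrite mul1r.
have e2 : pr g [set z | c < -1 * z] = pr g [set z | c < z].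
  rewrite /g -(pr_normalN (n_sqrt n0) (measurable_gtc c (@measurable_id _ _ setT))).
  by congr pr; apply/seteqP; split => z /=; rewrite mulN1r.
move: h1 h2; rewrite e1 e2; lra.
Qed.

End grid.
End levy.

(** * Paths, exit times and moments *)

(** The integral of a non-negative function is a supremum over the simple functions below it, hence
    monotone for arbitrary functions, in particular for powers of an exit time. *)
Lemma le_integral_nonneg {d} {T : measurableType d} {R : realType}
    (mu : {measure set T -> \bar R}) (f g : T -> \bar R) :
  (forall x, 0 <= f x)%E -> (forall x, f x <= g x)%E ->
  (\int[mu]_x f x <= \int[mu]_x g x)%E.
Proof.
move=> f0 fg; rewrite !ge0_integralTE//; last by move=> x; exact: le_trans (fg x).
apply: ereal_sup_le => _ [h /= hf <-]; exists h => //= x.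
exact: le_trans (fg x).
Qed.

Lemma integral_pr_indic {d} {T : measurableType d} {R : realType}
    (P : probability T R) (S : set T) : measurable S ->
  (\int[P]_w (\1_S w)%:E = (pr P S)%:E)%E.
Proof. by move=> mS; rewrite integral_indic// setIT; exact: prE. Qed.

(** Continuity from above: a bound uniform in the mesh passes to the event on all dyadic times. *)
Lemma pr_bigcap_ge {d} {T : measurableType d} {R : realType} (P : probability T R)
    (S : nat -> set T) (q : R) :
  (forall m, measurable (S m)) -> (forall m, S m.+1 `<=` S m) ->
  (forall m, q <= pr P (S m)) -> q <= pr P (\bigcap_m S m).
Proof.
move=> mS dS qS; have mI : measurable (\bigcap_m S m) by exact: bigcapT_measurable.
rewrite -lee_fin -prE//.
have ndS : nonincreasing_seq S.
  by apply/nonincreasing_seqP => m; apply/subsetPset.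
have F0 : (P (S 0%N) < +oo)%E by rewrite (prE P (mS 0%N)) ltry.
have cv := nonincreasing_cvg_mu F0 mS mI ndS.
rewrite -(cvg_lim _ cv)//; apply: lime_ge; first by apply/cvg_ex; eexists; exact: cv.
by apply: nearW => m /=; rewrite (prE P (mS m)) lee_fin.
Qed.

Lemma pr_bigcup_le {d} {T : measurableType d} {R : realType} (P : probability T R)
    (S : nat -> set T) (q : R) :
  (forall m, measurable (S m)) -> (forall m, S m `<=` S m.+1) ->
  (forall m, pr P (S m) <= q) -> pr P (\bigcup_m S m) <= q.
Proof.
move=> mS dS qS; have mU : measurable (\bigcup_m S m) by exact: bigcupT_measurable.
rewrite -lee_fin -prE//.
have ndS : nondecreasing_seq S.
  by apply/nondecreasing_seqP => m; apply/subsetPset.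
have cv := nondecreasing_cvg_mu mS mU ndS (mu := P).
rewrite -(cvg_lim _ cv)//; apply: lime_le; first by apply/cvg_ex; eexists; exact: cv.
by apply: nearW => m /=; rewrite (prE P (mS m)) lee_fin.
Qed.

Section paths.
Context {R : realType}.

Lemma dyadic_small (s e : R) : 0 < s -> 0 < e -> exists m : nat, s / (2 ^ m)%:R < e.
Proof.
move=> s0 e0; exists (Num.bound (s / e)).
have h := archi_boundP (ltW (divr_gt0 s0 e0)).
rewrite ltr_pdivrMr ?ltr0n ?expn_gt0//.
rewrite ltr_pdivrMr// in h; apply: (lt_le_trans h).
rewrite mulrC ler_wpM2l ?(ltW e0)// ler_nat.
by apply: ltnW; exact: ltn_expl.
Qed.

Lemma within_nonneg_near (f : R -> R) (u e : R) :
  {within [set t : R | 0 <= t], continuous f} -> 0 <= u -> 0 < e ->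
  exists2 e' : R, 0 < e' & forall v, 0 <= v -> `|u - v| < e' -> `|f u - f v| < e.
Proof.
move=> /subspace_continuousP cf u0 e0.
have /cvgrPdist_lt/(_ e e0) := cf u u0.
rewrite near_withinE => /nbhs_ballP[e' /= e'0 h].
by exists e' => // v v0 uv; exact: h.
Qed.

(** If f u < c, then by continuity f < c near u, and a fine enough grid has a point there. *)
Lemma dyadic_dense_ge (f : R -> R) (c t0 s : R) (n : nat) :
  {within [set t : R | 0 <= t], continuous f} -> 0 <= t0 -> 0 < s ->
  (forall m i : nat, (i <= n * 2 ^ m)%N -> c <= f (t0 + i%:R * (s / (2 ^ m)%:R))) ->
  forall u, t0 <= u -> u <= t0 + n%:R * s -> c <= f u.
Proof.
move=> cf t00 s0 H u tu uts; rewrite leNgt; apply/negP => fuc.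
have u0 : 0 <= u by exact: le_trans tu.
have cfu : 0 < c - f u by lra.
have [e e0 He] := within_nonneg_near cf u0 cfu.
have [m me] := dyadic_small s0 e0.
set eta := s / (2 ^ m)%:R in me.
have p2 : 0 < (2 ^ m)%:R :> R by rewrite ltr0n expn_gt0.
have eta0 : 0 < eta by rewrite divr_gt0.
have q0 : 0 <= (u - t0) / eta by rewrite divr_ge0 ?subr_ge0// ltW.
(* [i] indexes the last grid point not beyond u; rounding down keeps it inside the interval. *)
have /andP[i1 i2] := truncn_itv q0.
set i := Num.Def.trunc _ in i1 i2.
rewrite ler_pdivlMr// in i1; rewrite ltr_pdivrMr// -natr1 mulrDl mul1r in i2.
have inm : (i <= n * 2 ^ m)%N.
  rewrite -(ler_nat R) -(ler_pM2r eta0) natrM -mulrA.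
  by rewrite (_ : (2 ^ m)%:R * eta = s); [lra|rewrite /eta mulrC divfK// gt_eqF].
have := H m i inm; rewrite -/eta => h1.
have v0 : 0 <= t0 + i%:R * eta by rewrite addr_ge0// mulr_ge0// ltW.
have uv : `|u - (t0 + i%:R * eta)| < e by rewrite ltr_norml; apply/andP; split; lra.
by have := He _ v0 uv; rewrite ltr_norml => /andP[]; lra.
Qed.

End paths.

Section exit.
Context {R : realType} {T : Type} (D : set (R * R)) (X Y : R -> T -> R).

Lemma exit_time_ge (t : R) (w : T) :
  (forall u, 0 <= u -> u <= t -> D (X u w, Y u w)) -> (t%:E <= exit_time D X Y w)%E.
Proof.
move=> H; apply: le_ereal_inf_tmp => _ [u [u0 nD] <-]; rewrite lee_fin leNgt.
by apply/negP => ut; apply: nD; apply: H => //; exact: ltW.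
Qed.

Lemma exit_time_le (t : R) (w : T) :
  0 <= t -> ~ D (X t w, Y t w) -> (exit_time D X Y w <= t%:E)%E.
Proof. by move=> t0 nD; apply: ereal_inf_lbound; exists t. Qed.

Lemma exit_time_ge0 (w : T) : (0 <= exit_time D X Y w)%E.
Proof. by apply: le_ereal_inf_tmp => _ [u [u0 _] <-]; rewrite lee_fin. Qed.

End exit.

(** Restricting to S gives at least (n k)^p c / sqrt n = k^p c n^(p - 1/2), which is unbounded in
    n. *)
Lemma moment_infinite {d} {T : measurableType d} {R : realType} (P : probability T R)
    (tau : T -> \bar R) (c k p : R) : 0 < c -> 0 < k -> 1 / 2 < p ->
  (forall n : nat, (0 < n)%N -> exists S, [/\ measurable S,
     c / Num.sqrt n%:R <= pr P S & forall w, S w -> ((n%:R * k)%:E <= tau w)%E]) ->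
  (\int[P]_w (poweR (tau w) p) = +oo)%E.
Proof.
move=> c0 k0 p2 H; apply/eqyP => A A0.
pose e := p - 1 / 2.
have e0 : 0 < e by rewrite /e; lra.
pose C := k `^ p * c.
have C0 : 0 < C by rewrite mulr_gt0 ?powR_gt0.
(* The solution of C z^e = A; every n >= z brings the bound above A. *)
pose z := (A / C) `^ e^-1.
have z0 : 0 <= z by exact: powR_ge0.
pose n := (Num.bound z).+1.
have zn : z <= n%:R.
  by apply: ltW; apply: lt_trans (archi_boundP z0) _; rewrite ltr_nat.
have n0 : (0 < n)%N by [].
have nR : 0 < n%:R :> R by rewrite ltr0n.
have [S [mS cS St]] := H n n0.
apply: (@le_trans _ _ (((n%:R * k) `^ p) * pr P S)%:E).
  rewrite lee_fin; apply: (@le_trans _ _ ((n%:R * k) `^ p * (c / Num.sqrt n%:R))); last first.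
    by apply: ler_wpM2l => //; exact: powR_ge0.
  rewrite powRM ?ler0n ?(ltW k0)// -powR12_sqrt ?ler0n//.
  have -> : n%:R `^ p * k `^ p * (c / n%:R `^ 2^-1) = C * n%:R `^ e.
    have -> : n%:R `^ p = n%:R `^ e * n%:R `^ 2^-1.
      rewrite -powRD; first by congr (_ `^ _); rewrite /e; lra.
      by apply/implyP => _; rewrite gt_eqF.
    have q0 : 0 < n%:R `^ 2^-1 :> R by exact: powR_gt0.
    by rewrite /C; field; rewrite gt_eqF.
  rewrite mulrC -ler_pdivrMr//.
  have <- : z `^ e = A / C.
    by rewrite /z -powRrM mulVf ?gt_eqF// powRr1// divr_ge0// ltW.
  by apply: ge0_ler_powR; rewrite ?nnegrE//; exact: ltW.
apply: (@le_trans _ _ (\int[P]_w (((n%:R * k) `^ p)%:E * (\1_S w)%:E))%E).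
  rewrite ge0_integralZl ?lee_fin ?powR_ge0//; last first.
    exact/measurable_EFinP/measurable_indic.
  by rewrite integral_pr_indic// EFinM.
apply: le_integral_nonneg => w.
  by rewrite -EFinM lee_fin mulr_ge0 ?powR_ge0.
rewrite indicE; case: (boolP (w \in S)); rewrite ?inE => Sw; last first.
  by rewrite mule0; exact: poweR_ge0.
rewrite mule1 -poweR_EFin; apply: gt0_ler_poweR; last exact: St.
- lra.
- by rewrite in_itv/= leey lee_fin mulr_ge0 ?ler0n ?(ltW k0).
- rewrite in_itv/= leey andbT; apply: le_trans (St _ Sw).
  by rewrite lee_fin mulr_ge0 ?ler0n ?(ltW k0).
Qed.

(** * Survival probabilities from below *)

(** On [-c, c] the density is at least its value at c; its peak scales like 1 / sqrt n, and its
    exponential factor is smallest at n = 1. *)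
Lemma normal_central {R : realType} (c s : R) : 0 < c -> 0 < s ->
  exists2 k : R, 0 < k & forall n : nat, (0 < n)%N ->
    k / Num.sqrt n%:R <= pr (normal_prob 0 (Num.sqrt (n%:R * s))) `[- c, c].
Proof.
move=> c0 s0.
have ss0 : Num.sqrt s != 0 by rewrite gt_eqF// sqrtr_gt0.
have pk0 := normal_peak_gt0 ss0.
exists (2 * c * normal_peak (Num.sqrt s) * expR (- c ^+ 2 / (s *+ 2))).
  by rewrite !mulr_gt0// expR_gt0.
move=> n n0; have nR : 0 < n%:R :> R by rewrite ltr0n.
have n1 : 1 <= n%:R :> R by rewrite ler1n.
have ns0 : 0 < n%:R * s by rewrite mulr_gt0.
have sn0 : Num.sqrt (n%:R * s) != 0 by rewrite gt_eqF// sqrtr_gt0.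
have sqn0 : 0 < Num.sqrt n%:R :> R by rewrite sqrtr_gt0.
have peakE : normal_peak (Num.sqrt (n%:R * s)) = normal_peak (Num.sqrt s) / Num.sqrt n%:R.
  have E (p : R) : (Num.sqrt (Num.sqrt (n%:R * s) ^+ 2 * p *+ 2))^-1 =
      (Num.sqrt (Num.sqrt s ^+ 2 * p *+ 2))^-1 / Num.sqrt n%:R.
    rewrite !sqr_sqrtr ?(ltW ns0) ?(ltW s0)//.
    have -> : n%:R * s * p *+ 2 = n%:R * (s * p *+ 2).
      by rewrite -(mulr_natr (s * p)) -(mulr_natr (n%:R * s * p)); ring.
    rewrite sqrtrM ?ler0n// invfM; exact: mulrC.
  exact: E.
have := @normal_prob_itv_ge R _ c (- c) c sn0 (lexx _) ltac:(lra) (lexx _).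
rewrite (prE (normal_prob 0 (Num.sqrt (n%:R * s)))) // lee_fin; apply: le_trans.
rewrite normal_pdf0E// peakE sqr_sqrtr ?(ltW ns0)//.
have e1 : expR (- c ^+ 2 / (s *+ 2)) <= expR (- c ^+ 2 / (n%:R * s *+ 2)).
  rewrite ler_expR !mulNr lerN2 ler_wpM2l ?sqr_ge0// lef_pV2 ?posrE ?mulrn_wgt0//.
  by rewrite lerMn2r orFb; nra.
have q0 : 0 <= 2 * c * normal_peak (Num.sqrt s) / Num.sqrt n%:R.
  by apply: divr_ge0; [rewrite !mulr_ge0// ltW|exact: ltW].
have := ler_wpM2l q0 e1; lra.
Qed.

Section lower.
Context {R : realType} {d : measure_display} {T : measurableType d}.
Context (P : probability T R) (a : R * R) (X Y : R -> T -> R).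
Hypothesis BM : planar_BM P a X Y.

Lemma BM_lawX (s t : R) (B : set R) : 0 <= s -> s < t -> measurable B ->
  pr P [set w | B (X t w - X s w)] = pr (normal_prob 0 (Num.sqrt (t - s))) B.
Proof.
move=> s0 st mB; have := BM_increment_law BM s0 st mB measurableT.
have -> : fine (normal_prob 0 (Num.sqrt (t - s)) setT) = 1 :> R := prT (normal_prob 0 (Num.sqrt (t - s))).
rewrite mulr1 => E; apply: etrans E.
by congr pr; apply/seteqP; split => w //= [].
Qed.

Lemma BM_lawY (s t : R) (B : set R) : 0 <= s -> s < t -> measurable B ->
  pr P [set w | B (Y t w - Y s w)] = pr (normal_prob 0 (Num.sqrt (t - s))) B.
Proof.
move=> s0 st mB; have := BM_increment_law BM s0 st measurableT mB.
have -> : fine (normal_prob 0 (Num.sqrt (t - s)) setT) = 1 :> R := prT (normal_prob 0 (Num.sqrt (t - s))).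
rewrite mul1r => E; apply: etrans E.
by congr pr; apply/seteqP; split => w //= [].
Qed.

Section grid.
Variables (h : R) (N : nat) (h0 : 0 < h).

Lemma grid_within_measurable (I J : set nat) (j n : nat) (c : R) :
  (j + n <= N)%N -> (forall i, (j <= i)%N -> (i < j + n)%N -> I i) ->
  <<s cylinders X Y h N I J >>
    [set w | forall i, (i < n.+1)%N -> `|X ((j + i)%:R * h) w - X (j%:R * h) w| <= c].
Proof.
move=> jnN Ij.
apply: (@measurable_forall_lt _ (g_sigma_algebraType (cylinders X Y h N I J)) n.+1 (fun i =>
  [set w | `|X ((j + i)%:R * h) w - X (j%:R * h) w| <= c])) => i i_n.
apply: measurable_lec; apply: measurableT_comp; first exact: normr_measurable.
apply: measurable_diff_gridX; first exact: leq_addr.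
  by apply: leq_trans jnN; rewrite leq_add2l.
by move=> k jk ki; apply: Ij => //; apply: leq_trans ki _; rewrite leq_add2l.
Qed.

Lemma grid_above_measurable (I J : set nat) (j n : nat) (c : R) :
  (j + n <= N)%N -> (forall i, (j <= i)%N -> (i < j + n)%N -> J i) ->
  <<s cylinders X Y h N I J >>
    [set w | forall i, (i < n.+1)%N -> - c <= Y ((j + i)%:R * h) w - Y (j%:R * h) w].
Proof.
move=> jnN Ij.
apply: (@measurable_forall_lt _ (g_sigma_algebraType (cylinders X Y h N I J)) n.+1 (fun i =>
  [set w | - c <= Y ((j + i)%:R * h) w - Y (j%:R * h) w])) => i i_n.
apply: measurable_gec; apply: measurable_diff_gridY; first exact: leq_addr.
  by apply: leq_trans jnN; rewrite leq_add2l.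
by move=> k jk ki; apply: Ij => //; apply: leq_trans ki _; rewrite leq_add2l.
Qed.

Lemma BM_pr_above (c : R) (j n : nat) : 0 <= c -> (0 < n)%N -> (j + n <= N)%N ->
  pr (normal_prob 0 (Num.sqrt (n%:R * h))) `[- c, c] <=
  pr P [set w | forall i, (i < n.+1)%N -> - c <= Y ((j + i)%:R * h) w - Y (j%:R * h) w].
Proof.
move=> c0 n0 jnN.
apply: (@pr_grid_above _ _ _ P Y h N h0
  (fun i k => cylinders X Y h N set0 [set l | (i <= l < k)%N])) => //.
- move=> i k l l' kN il ll' l'k; apply: measurable_diff_gridY => //.
    exact: leq_trans kN.
  by move=> u lu ul' /=; rewrite (leq_trans il lu) (leq_trans ul' l'k).
- by move=> i k E; exact: (gridT_measurable BM).
- move=> i k l; apply: (independent_grid BM) => //; first by rewrite setI0.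
  apply/seteqP; split => // u [/= /andP[_ uk] /andP[ku _]].
  by move: (leq_trans uk ku); rewrite ltnn.
- exact: BM_lawY.
Qed.

Lemma BM_pr_within (c : R) (j n : nat) : 0 < c -> (0 < n)%N -> (j + n <= N)%N ->
  1 - 1024 * (n%:R * h) ^+ 2 / c ^+ 4 <=
  pr P [set w | forall i, (i < n.+1)%N -> `|X ((j + i)%:R * h) w - X (j%:R * h) w| <= c].
Proof.
move=> c0 n0 jnN.
apply: (@pr_grid_within _ _ _ P X h N h0
  (fun i k => cylinders X Y h N [set l | (i <= l < k)%N] set0)) => //.
- move=> i k l l' kN il ll' l'k; apply: measurable_diff_gridX => //.
    exact: leq_trans kN.
  by move=> u lu ul' /=; rewrite (leq_trans il lu) (leq_trans ul' l'k).
- by move=> i k E; exact: (gridT_measurable BM).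
- move=> i k l; apply: (independent_grid BM) => //; last by rewrite setI0.
  apply/seteqP; split => // u [/= /andP[_ uk] /andP[ku _]].
  by move: (leq_trans uk ku); rewrite ltnn.
- exact: BM_lawX.
Qed.

End grid.

Let dyadicE (s : R) (m i : nat) :
  i%:R * (s / (2 ^ m)%:R) = (i * 2)%:R * (s / (2 ^ m.+1)%:R).
Proof.
rewrite expnS !natrM; field.
by rewrite pnatr_eq0 -lt0n expn_gt0.
Qed.

Let dyadicK (s : R) (m n : nat) : (n * 2 ^ m)%:R * (s / (2 ^ m)%:R) = n%:R * s.
Proof.
by rewrite natrM; field; rewrite pnatr_eq0 -lt0n expn_gt0.
Qed.

Let dyadic_ltn (n m i : nat) : (i < (n * 2 ^ m).+1)%N -> (i * 2 < (n * 2 ^ m.+1).+1)%N.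
Proof. by rewrite expnS mulnCA (mulnC i) !ltnS leq_mul2l. Qed.

Let dyadic_gt0 (s : R) (m : nat) : 0 < s -> 0 < s / (2 ^ m)%:R.
Proof. by move=> s0; rewrite divr_gt0// ltr0n expn_gt0. Qed.

(** The margin a.2 / 2 lets a closed inequality on the dyadic times still give strict positivity at
    all times. *)
Lemma upper_survival : 0 < a.2 -> exists2 c : R, 0 < c &
  forall n : nat, (0 < n)%N -> exists S : set T, [/\ measurable S,
    c / Num.sqrt n%:R <= pr P S &
    forall w, S w -> forall u, 0 <= u -> u <= n%:R -> 0 < Y u w].
Proof.
move=> a0; have [_ B0 cXY _] := BM.
have a20 : 0 < a.2 / 2 by lra.
have [c c0 Hc] := normal_central a20 (@ltr01 R).
exists c => // n n0.
pose h m : R := 1 / (2 ^ m)%:R.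
pose S m := [set w | forall i, (i < (n * 2 ^ m).+1)%N ->
  - (a.2 / 2) <= Y ((0 + i)%:R * h m) w - Y (0%:R * h m) w].
have nm m : (0 < n * 2 ^ m)%N by rewrite muln_gt0 n0 expn_gt0.
have mS m : measurable (S m).
  apply: (@gridT_measurable _ _ _ P a X Y BM (h m) (n * 2 ^ m) setT setT).
  exact: grid_above_measurable.
exists (\bigcap_m S m); split; first exact: bigcapT_measurable.
  apply: pr_bigcap_ge => // m.
    move=> w Sw i i_n; rewrite add0n dyadicE mul0r -(mul0r (h m.+1)).
    rewrite -{1}[(i * 2)%N]add0n; apply: Sw.
    exact: dyadic_ltn.
  apply: (le_trans (Hc n n0)).
  have := @BM_pr_above (h m) (n * 2 ^ m) (dyadic_gt0 m ltr01) (a.2 / 2) 0 (n * 2 ^ m)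
    (ltW a20) (nm m) (leqnn _).
  by rewrite dyadicK.
move=> w Sw u u0 un; have [_ cY] := cXY w.
apply: (@lt_le_trans _ _ (a.2 / 2)) => //.
apply: (@dyadic_dense_ge R (fun t => Y t w) _ 0 1 n) => //; last by rewrite add0r mulr1.
move=> m i i_n; have := Sw m I i; rewrite ltnS => /(_ i_n).
rewrite add0n mul0r add0r; have [_ ->] := B0 w; rewrite /h; lra.
Qed.

(** Three independent events: X moves by at most e up to time s, Y gains at least 1 by time s, and Y
    loses at most 1/2 afterwards. The first two are independent as events of different coordinates,
    the third as a later one; only its probability depends on n. *)
Lemma gap_survival (e : R) : 0 < e -> exists s c : R, [/\ 0 < s, 0 < c &
  forall n : nat, (0 < n)%N -> exists S : set T, [/\ measurable S,
    c / Num.sqrt n%:R <= pr P S &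
    forall w, S w -> (forall u, 0 <= u -> u <= s -> `|X u w - a.1| <= e) /\
      (forall u, s <= u -> u <= s + n%:R * s -> a.2 < Y u w)]].
Proof.
move=> e0; have [_ B0 cXY _] := BM.
(* With this [s] the error 1024 s^2 / e^4 of [BM_pr_within] is 1/4. *)
pose s := e ^+ 2 / 64.
have s0 : 0 < s by rewrite /s divr_gt0// exprn_gt0.
have ss0 : Num.sqrt s != 0 by rewrite gt_eqF// sqrtr_gt0.
have half0 : 0 < 1 / 2 :> R by lra.
have [c c0 Hc] := normal_central half0 s0.
pose q := pr (normal_prob 0 (Num.sqrt s)) [set z : R | 1 <= z].
have m1 : measurable [set z : R | 1 <= z] by exact: measurable_gec.
have q0 : 0 < q.
  have : 0 < pr (normal_prob 0 (Num.sqrt s)) `[1, 2].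
    rewrite -lte_fin -(prE (normal_prob 0 (Num.sqrt s)))//.
    by apply: normal_prob_itv_gt0 => //; lra.
  move=> /lt_le_trans; apply; apply: pr_le => //.
  by move=> z /=; rewrite in_itv/= => /andP[].
exists s, (1 / 2 * q * c); split => //; first by rewrite !mulr_gt0.
move=> n n0.
pose h m : R := s / (2 ^ m)%:R.
have h0 m : 0 < h m by exact: dyadic_gt0.
pose N m := (2 ^ m + n * 2 ^ m)%N.
pose S1 m := [set w | forall i, (i < (2 ^ m).+1)%N ->
  `|X ((0 + i)%:R * h m) w - X (0%:R * h m) w| <= e].
pose S2 m := [set w | 1 <= Y ((2 ^ m)%:R * h m) w - Y (0%:R * h m) w].
pose S3 m := [set w | forall i, (i < (n * 2 ^ m).+1)%N ->
  - (1 / 2) <= Y ((2 ^ m + i)%:R * h m) w - Y ((2 ^ m)%:R * h m) w].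
have K0 m : (0 < 2 ^ m)%N by rewrite expn_gt0.
have nm m : (0 < n * 2 ^ m)%N by rewrite muln_gt0 n0 expn_gt0.
have KN m : (2 ^ m <= N m)%N by exact: leq_addr.
have Kh m : (2 ^ m)%:R * h m = s by have := dyadicK s m 1; rewrite mul1n mul1r.
pose I1 m := [set i | (i < 2 ^ m)%N].
have s1 m J : <<s cylinders X Y (h m) (N m) (I1 m) J >> (S1 m).
  by apply: grid_within_measurable; rewrite ?add0n.
have s2 m I : <<s cylinders X Y (h m) (N m) I (I1 m) >> (S2 m).
  apply: (@measurable_gec R _ (g_sigma_algebraType (cylinders X Y (h m) (N m) I (I1 m)))).
  exact: measurable_diff_gridY.
have s3 m I : <<s cylinders X Y (h m) (N m) I [set i | (2 ^ m <= i)%N] >> (S3 m).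
  by apply: grid_above_measurable.
have mS1 m : measurable (S1 m) by apply: (gridT_measurable BM); exact: (s1 m setT).
have mS2 m : measurable (S2 m) by apply: (gridT_measurable BM); exact: (s2 m setT).
have mS3 m : measurable (S3 m) by apply: (gridT_measurable BM); exact: (s3 m setT).
pose S m := S1 m `&` S2 m `&` S3 m.
have mS m : measurable (S m) by do 2?[apply: measurableI].
exists (\bigcap_m S m); split; first exact: bigcapT_measurable.
  apply: pr_bigcap_ge => // m.
    have step i : (i < (2 ^ m).+1)%N -> (i * 2 < (2 ^ m.+1).+1)%N.
      by have := @dyadic_ltn 1 m i; rewrite !mul1n.
    move=> w [[H1 H2] H3]; split; [split|].
    - move=> i i_n; rewrite add0n dyadicE mul0r -(mul0r (h m.+1)).
      by rewrite -{1}[(i * 2)%N]add0n; apply: H1; exact: step.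
    - by move: H2; rewrite /S2 /= !Kh !mul0r.
    - move=> i i_n; have := H3 (i * 2)%N (dyadic_ltn i_n).
      by rewrite !Kh expnSr -mulnDl -dyadicE.
  have -> : pr P (S m) = pr P (S1 m) * pr P (S2 m) * pr P (S3 m).
    have <- : pr P (S1 m `&` S2 m) = pr P (S1 m) * pr P (S2 m).
      apply: (@independent_grid _ _ _ P a X Y BM (h m) (N m) (h0 m) (I1 m) set0
        set0 (I1 m)); [exact: setI0|exact: set0I|exact: s1|exact: s2].
    apply: (@independent_grid _ _ _ P a X Y BM (h m) (N m) (h0 m) (I1 m) (I1 m)
       set0 [set i | (2 ^ m <= i)%N]); [exact: setI0| | |exact: s3].
    - by apply/seteqP; split => // i [] /=; rewrite /I1 /= ltnNge => /negP.
    - apply: (@measurableI _ (g_sigma_algebraType (cylinders X Y (h m) (N m) (I1 m) (I1 m))));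
        [exact: s1|exact: s2].
  have p1 : 1 / 2 <= pr P (S1 m).
    have := @BM_pr_within (h m) (2 ^ m) (h0 m) e 0 (2 ^ m) e0 (K0 m) (leqnn _).
    apply: le_trans; rewrite Kh.
    have -> : 1024 * s ^+ 2 / e ^+ 4 = 1 / 4 by rewrite /s; field; rewrite gt_eqF.
    lra.
  have p2 : pr P (S2 m) = q.
    have := BM_lawY (lexx 0) s0 m1; rewrite subr0 -/q => <-.
    by rewrite /S2 Kh mul0r.
  have p3 : c / Num.sqrt n%:R <= pr P (S3 m).
    apply: (le_trans (Hc n n0)).
    have := @BM_pr_above (h m) (N m) (h0 m) (1 / 2) (2 ^ m) (n * 2 ^ m)
      (ltW half0) (nm m) (leqnn _).
    by rewrite dyadicK.
  rewrite p2.
  have t0 : 0 <= c / Num.sqrt n%:R by rewrite divr_ge0 ?sqrtr_ge0// ltW.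
  have u0 : 1 / 2 * q <= pr P (S1 m) * q by rewrite ler_wpM2r// ltW.
  have := ler_pM (mulr_ge0 (ltW half0) (ltW q0)) t0 u0 p3; lra.
move=> w Sw; have [cX cY] := cXY w; have [X0 Y0] := B0 w.
have cNX : {within [set t : R | 0 <= t], continuous (fun t => - X t w)}.
  by move=> t; apply: cvgN; exact: cX.
split=> u us1 us2.
  have h1 : a.1 - e <= X u w.
    apply: (@dyadic_dense_ge R (fun t => X t w) _ 0 s 1) => //; last by rewrite add0r mul1r.
    move=> m i; rewrite mul1n => i_n; have [[/(_ i)+ _] _] := Sw m I.
    by rewrite ltnS => /(_ i_n); rewrite add0n mul0r add0r X0 ler_norml /h; lra.
  have h2 : - a.1 - e <= - X u w.
    apply: (@dyadic_dense_ge R (fun t => - X t w) _ 0 s 1) => //; last by rewrite add0r mul1r.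
    move=> m i; rewrite mul1n => i_n; have [[/(_ i)+ _] _] := Sw m I.
    by rewrite ltnS => /(_ i_n); rewrite add0n mul0r add0r X0 ler_norml /h; lra.
  by rewrite ler_norml; apply/andP; split; lra.
suff : a.2 + 1 / 2 <= Y u w by lra.
apply: (@dyadic_dense_ge R (fun t => Y t w) _ s s n) => //; first exact: ltW.
move=> m i i_n; have [[_ H2] /(_ i)] := Sw m I.
rewrite ltnS => /(_ i_n); rewrite natrD mulrDl Kh /h => h3.
by move: H2; rewrite /S2 /= Kh mul0r Y0; lra.
Qed.

End lower.

(** * From a Lyapunov drift to moments *)

(** In the application [e], [dr] and [p] are the height, the drift and the probability of being
    alive in block k. The killing terms telescope to at most C, so heights and total drift are
    bounded by W = e 0 + C. Summing the split over k < n, with p n <= p k, gives n p n <= W (n / L^b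
    + L^(2 - b) / eps), and L^2 = n balances both terms. *)
Lemma lyapunov_tail {R : realType} (e dr p : nat -> R) (n : nat) (C eps b : R) :
  (0 < n)%N -> 0 < eps -> 0 <= C ->
  (forall k, 0 <= e k) -> (forall k, 0 <= dr k) -> (forall k, 0 <= p k) -> p 0%N <= 1 ->
  (forall k, p k.+1 <= p k) ->
  (forall k, (k < n)%N -> e k.+1 + dr k <= e k + C * (p k - p k.+1)) ->
  (forall k, (k < n)%N -> p k <= e k / Num.sqrt n%:R `^ b +
     dr k * (Num.sqrt n%:R `^ (2 - b) / eps)) ->
  p n <= (e 0%N + C) * (1 + eps^-1) / Num.sqrt n%:R `^ b.
Proof.
move=> n0 eps0 C0 e0 dr0 p0 p1 dp step split.
set L := Num.sqrt n%:R in split *.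
have nR : 0 < n%:R :> R by rewrite ltr0n.
have L0 : 0 < L by rewrite sqrtr_gt0.
have Lb : 0 < L `^ b by exact: powR_gt0.
set W := e 0%N + C.
have W0 : 0 <= W by rewrite addr_ge0.
have acc k : (k <= n)%N -> e k + \sum_(i < k) dr i <= e 0%N + C * (p 0%N - p k).
  elim: k => [|k IH] kn; first by rewrite big_ord0 subrr mulr0 !addr0.
  rewrite big_ord_recr /=; have := IH (ltnW kn); have := step k kn; lra.
have accW k : (k <= n)%N -> e k + \sum_(i < k) dr i <= W.
  move=> kn; apply: (le_trans (acc k kn)); rewrite lerD2l.
  by rewrite -[leRHS]mulr1 ler_wpM2l//; have := p0 k; lra.
have sum0 k : 0 <= \sum_(i < k) dr i by apply: sumr_ge0.
have eW k : (k <= n)%N -> e k <= W by move=> kn; have := accW k kn; have := sum0 k; lra.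
have drW : \sum_(i < n) dr i <= W by have := accW n (leqnn n); have := e0 n; lra.
have pn k : (k <= n)%N -> p n <= p k.
  move=> kn; rewrite -(subnK kn); elim: (n - k)%N => // j IH.
  by rewrite addSn; exact: le_trans (dp _) IH.
have L2 : n%:R = L ^+ 2 by rewrite sqr_sqrtr// ltW.
have L2b : L `^ (2 - b) = L ^+ 2 / L `^ b.
  rewrite powRD; last by apply/implyP => _; rewrite gt_eqF.
  by rewrite powRN (powR_mulrn 2)// ltW.
have : n%:R * p n <= n%:R * (W / L `^ b) + W * (L `^ (2 - b) / eps).
  apply: (@le_trans _ _ (\sum_(i < n) (W / L `^ b + dr i * (L `^ (2 - b) / eps)))).
    rewrite mulr_natl -[X in _ *+ X]card_ord -sumr_const.
    apply: ler_sum => i _; apply: (le_trans (pn i (ltnW (ltn_ord i)))).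
    apply: (le_trans (split i (ltn_ord i))); rewrite lerD2r.
    by rewrite ler_pM2r ?invr_gt0//; apply: eW; exact: ltnW.
  rewrite big_split/= sumr_const card_ord mulr_natl lerD2l -mulr_suml.
  by rewrite ler_wpM2r// divr_ge0 ?powR_ge0// ltW.
rewrite L2b L2 => H.
have L20 : 0 < L ^+ 2 by rewrite exprn_gt0.
rewrite -(ler_pM2l L20); apply: (le_trans H).
have -> // : L ^+ 2 * (W / L `^ b) + W * (L ^+ 2 / L `^ b / eps) =
  L ^+ 2 * (W * (1 + eps^-1) / L `^ b) by field; rewrite !gt_eqF.
Qed.

(** Dyadic layers: where 2^j k < tau <= 2^(j + 1) k, the power is at most k^p 2^((j + 1) p), on an
    event of probability at most K 2^(- j b / 2). The series is geometric with ratio 2^(p - b / 2) <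
    1. *)
Lemma moment_finite {d} {T : measurableType d} {R : realType} (P : probability T R)
    (tau : T -> \bar R) (S : nat -> set T) (K k b p : R) :
  0 <= K -> 0 < k -> 0 < p -> p < b / 2 -> (forall w, 0 <= tau w)%E ->
  (forall n, measurable (S n)) ->
  (forall n, (0 < n)%N -> pr P (S n) <= K / Num.sqrt n%:R `^ b) ->
  (forall n w, ((n%:R * k)%:E < tau w)%E -> S n w) ->
  (\int[P]_w (poweR (tau w) p) < +oo)%E.
Proof.
move=> K0 k0 p0 pb tau0 mS SK tS.
pose q : R := 2 `^ p; pose v : R := 2 `^ (b / 2).
have q0 : 0 < q by exact: powR_gt0.
have v0 : 0 < v by exact: powR_gt0.
have qv : q < v.
  have two0 : (2 == 0 :> R) = false by apply/eqP; lra.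
  rewrite /q /v /powR two0 ltr_expR ltr_pM2r//; apply: ln_gt0; lra.
have two j : (2 ^ j)%:R = 2 `^ j%:R :> R by rewrite natrX powR_mulrn.
have qn j : (2 ^ j)%:R `^ p = q ^+ j.
  rewrite two -powRrM mulrC powRrM powR_mulrn; [by []|exact: powR_ge0].
have vn j : Num.sqrt (2 ^ j)%:R `^ b = v ^+ j.
  rewrite two -powR12_sqrt; last exact: powR_ge0.
  rewrite -powRrM -powRrM (_ : j%:R * (2^-1 * b) = b / 2 * j%:R); last by lra.
  by rewrite powRrM powR_mulrn; [|exact: powR_ge0].
pose A := k `^ p.
have A0 : 0 <= A by exact: powR_ge0.
pose f j w : \bar R := ((A * q ^+ j.+1)%:E * (\1_(S (2 ^ j)%N) w)%:E)%E.
have c0 j : 0 <= A * q ^+ j.+1 by rewrite mulr_ge0// exprn_ge0// ltW.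
have f0 j w : (0 <= f j w)%E by rewrite /f -EFinM lee_fin mulr_ge0.
have mf j : measurable_fun setT (f j).
  by apply: emeasurable_funM => //; exact/measurable_EFinP/measurable_indic.
have fS j w : S (2 ^ j)%N w -> ((A * q ^+ j.+1)%:E <= \sum_(i <oo) f i w)%E.
  move=> Sw; have := @nneseries_lim_ge R (fun i => f i w) xpredT 0%N j.+1 (fun n _ _ => f0 n w).
  apply: le_trans; rewrite big_nat_recr//= {2}/f indicE mem_set// mule1 leeDr//.
  by apply: sume_ge0 => i _; exact: f0.
(* Stated for all real t below tau, so that for tau = +oo letting t grow shows the series to be
   infinite as well. *)
have real_bound w (t : R) : 0 <= t -> (t%:E <= tau w)%E ->
    ((t `^ p)%:E <= A%:E + \sum_(i <oo) f i w)%E.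
  move=> t0 tt; have s0 : (0 <= \sum_(i <oo) f i w)%E by apply: nneseries_ge0.
  have [tk|kt] := lerP t k.
    apply: (@le_trans _ _ A%:E); last by rewrite leeDl.
    by rewrite lee_fin; apply: ge0_ler_powR; rewrite ?nnegrE//; exact: ltW.
  have exj : exists j, t <= (2 ^ j.+1)%:R * k.
    exists (Num.bound (t / k)).
    have := archi_boundP (divr_ge0 t0 (ltW k0)); rewrite ltr_pdivrMr// => h.
    apply: (le_trans (ltW h)); rewrite ler_pM2r// ler_nat.
    by apply: ltnW; apply: leq_trans (ltn_expl _ (isT : (1 < 2)%N)) _; rewrite leq_exp2l.
  have [j tj minj] := ex_minnP exj.
  have jt : (2 ^ j)%:R * k < t.
    (* At j = 0 minimality says nothing, and the claim is the case assumption k < t. *)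
    case: j tj minj => [|j] tj minj; first by rewrite expn0 mul1r.
    by rewrite ltNge; apply/negP => /minj; rewrite ltnn.
  have Sw : S (2 ^ j)%N w by apply: tS; apply: lt_le_trans tt; rewrite lte_fin.
  apply: (@le_trans _ _ (A * q ^+ j.+1)%:E).
    rewrite lee_fin -qn mulrC -powRM ?ler0n ?(ltW k0)//.
    by apply: ge0_ler_powR; rewrite ?nnegrE ?mulr_ge0//; exact: ltW.
  by apply: (le_trans (fS j w Sw)); rewrite leeDr// lee_fin.
apply: (@le_lt_trans _ _ (\int[P]_w (A%:E + \sum_(i <oo) f i w))%E).
  apply: le_integral_nonneg => w; first exact: poweR_ge0.
  have := tau0 w; case E : (tau w) => [t||]//= t0; last first.
    rewrite gt_eqF// leye_eq; apply/eqP/eqyP => z z0.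
    have := real_bound w (z `^ p^-1) (powR_ge0 _ _); rewrite E leey => /(_ isT).
    by rewrite -powRrM mulVf ?gt_eqF// powRr1// ltW.
  by apply: real_bound; rewrite ?E.
rewrite ge0_integralD//; last 2 first.
- by move=> w _; apply: nneseries_ge0.
- by apply: ge0_emeasurable_sum.
have iA : (\int[P]_w A%:E = A%:E)%E.
  transitivity (A%:E * P setT)%E; first exact: (integral_cst P measurableT A%:E).
  by rewrite (prE P measurableT) prT mule1.
rewrite iA integral_nneseries//.
pose x := q / v.
have x0 : 0 < x by rewrite divr_gt0.
have x1 : x < 1 by rewrite ltr_pdivrMr// mul1r.
have If j : (\int[P]_w f j w <= (A * q * K * x ^+ j)%:E)%E.
  rewrite /f ge0_integralZl//; last 2 first.
  - exact/measurable_EFinP/measurable_indic.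
  - by rewrite lee_fin.
  rewrite integral_pr_indic// -EFinM lee_fin.
  apply: (@le_trans _ _ (A * q ^+ j.+1 * (K / v ^+ j))).
    by apply: ler_wpM2l => //; rewrite -vn; apply: SK; rewrite expn_gt0.
  have vj : v ^+ j != 0 by rewrite gt_eqF// exprn_gt0.
  have -> // : A * q ^+ j.+1 * (K / v ^+ j) = A * q * K * x ^+ j.
  by rewrite /x expr_div_n exprS; field.
apply: (@le_lt_trans _ _ (A%:E + (A * q * K * (1 - x)^-1)%:E)%E); last by rewrite -EFinD ltry.
rewrite leeD2l//; apply: lime_le; first by apply: is_cvg_nneseries => j _ _; apply: integral_ge0.
apply: nearW => n; apply: (@le_trans _ _ (\sum_(0 <= i < n) (A * q * K * x ^+ i)%:E)%E).
  by apply: lee_sum => i _; exact: If.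
rewrite sumEFin lee_fin; apply: geometric_le_lim => //.
- by rewrite !mulr_ge0// ltW.
- by rewrite gtr0_norm.
Qed.

(** * Crossing a dash *)

Lemma integral_normal_law {R : realType} {d} {T : measurableType d} (P : probability T R)
    (s : R) (W : T -> R) : measurable_fun setT W ->
  (forall A : set R, measurable A -> pr P (W @^-1` A) = pr (normal_prob 0 s) A) ->
  forall f : R -> \bar R, measurable_fun setT f -> (forall z, 0 <= f z)%E ->
  (\int[P]_w f (W w) = \int[normal_prob 0 s]_z f z)%E.
Proof.
move=> mW law f mf f0.
have mW' : measurable_fun setT (W : T -> measurableTypeR R) := mW.
transitivity (\int[pushforward P (W : T -> measurableTypeR R)]_z f z)%E.
  rewrite ge0_integral_pushforward; [by rewrite preimage_setT|exact: mW'|by []|exact: mf|].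
  by move=> z _; exact: f0.
apply: eq_measure_integral => A mA _.
have mWA : measurable (W @^-1` A) by rewrite -[X in measurable X]setTI; exact: mW.
transitivity (P (W @^-1` A)) => //.
rewrite (prE P mWA) law//; apply/esym; exact: (prE (normal_prob 0 s) mA).
Qed.

Lemma fine_leD {R : realType} (u v w : \bar R) (q : R) :
  u \is a fin_num -> v \is a fin_num -> w \is a fin_num ->
  (u + v <= w + q%:E)%E -> fine u + fine v <= fine w + q.
Proof. by move: u v w => [u||] [v||] [w||]. Qed.

Section killing.
Context {R : realType} {d : measure_display} {T : measurableType d}.
Context (P : probability T R) (a : R * R) (X Y : R -> T -> R).
Hypothesis BM : planar_BM P a X Y.
Variables (x r : R) (r0 : 0 < r) (rx : r < x).

Let x0 : 0 < x. Proof. exact: lt_trans rx. Qed.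

(* The time scale is chosen so that the oscillation of [X] stays below [r / 2]
   with probability at least [3 / 4]. *)
Definition dwell : R := (r / 2) ^+ 2 / 64.
Let h0 : 0 < dwell. Proof. by rewrite /dwell divr_gt0// exprn_gt0// divr_gt0. Qed.

Definition mesh (m : nat) : R := dwell / (2 ^ m)%:R.
Let eta0 m : 0 < mesh m. Proof. by rewrite /mesh divr_gt0// ltr0n expn_gt0. Qed.

(** The time does not depend on [m], see [tmE]; written as a multiple of [mesh m], it falls under
    the grid lemmas. *)
Definition tick (m j : nat) : R := (j * 2 ^ m)%:R * mesh m.
Let tmE m j : tick m j = j%:R * dwell.
Proof. by rewrite /tick /mesh natrM; field; rewrite pnatr_eq0 -lt0n expn_gt0. Qed.

(** A countable union indexed by naturals with both signs, for measurability. The half-width r / 2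
    leaves r / 2 for the later oscillation of X. *)
Definition near_dash : set R :=
  \bigcup_(i : nat) ([set y | `|y - i%:R * x| <= r / 2] `|`
                     [set y | `|y + i%:R * x| <= r / 2]).

Lemma measurable_near_dash : measurable near_dash.
Proof.
apply: bigcupT_measurable => i; apply: measurableU; apply: measurable_lec.
  by apply: measurableT_comp; [exact: normr_measurable|exact: measurable_funB].
by apply: measurableT_comp; [exact: normr_measurable|exact: measurable_funD].
Qed.

Lemma near_dashP (y : R) :
  near_dash y <-> exists n : int, `|y - n%:~R * x| <= r / 2.
Proof.
split=> [[i _ [H|H]]|[[i|i] H]].
- by exists i.
- by exists (- i%:Z); rewrite mulrNz mulNr opprK.
- by exists i => //; left.
- by exists i.+1 => //; right; move: H; rewrite NegzE mulrNz mulNr opprK.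
Qed.

(* In block [k], [X] sits near the centre of a dash at time [2k+1] (in units of
   [dwell]) and stays on that dash until time [2k+2], while [Y] changes sign. *)
Definition kill (m k : nat) : set T := [set w | near_dash (X (tick m (2 * k + 1)) w)] `&`
  [set w | forall i, (i < (2 ^ m).+1)%N -> `|X (((2 * k + 1) * 2 ^ m + i)%:R * mesh m) w
     - X (((2 * k + 1) * 2 ^ m)%:R * mesh m) w| <= r / 2] `&`
  [set w | 0 <= Y (tick m (2 * k + 1)) w] `&` [set w | Y (tick m (2 * k + 2)) w <= 0].

Definition alive (m n : nat) : set T := [set w | forall k, (k < n)%N -> (~` kill m k) w].

(** * Blocks at one mesh and one time horizon *)

Section fixed.
Variables (m n : nat).
Let N : nat := (2 * n * 2 ^ m)%N.
Let G (I J : set nat) := cylinders X Y (mesh m) N I J.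
Let upto (j : nat) : set nat := [set i | (i < j * 2 ^ m)%N].
Let from (j : nat) : set nat := [set i | (j * 2 ^ m <= i)%N].

Let jN j : (j <= 2 * n)%N -> (j * 2 ^ m <= N)%N.
Proof. by move=> jn; rewrite /N leq_mul2r jn orbT. Qed.

Let upto_from j : upto j `&` from j = set0.
Proof. by apply/seteqP; split => // i []; rewrite /upto /from /= ltnNge => /negP. Qed.

Let mX j j' : (j <= j')%N -> (j' <= 2 * n)%N ->
  measurable_fun setT (X (tick m j) : g_sigma_algebraType (G (upto j') (upto j')) -> R).
Proof.
move=> jj' jn; apply: (measurable_gridX BM) => [|i ij]; first exact/jN/(leq_trans jj').
by apply: leq_trans ij _; rewrite leq_mul2r jj' orbT.
Qed.

Let mY j j' : (j <= j')%N -> (j' <= 2 * n)%N ->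
  measurable_fun setT (Y (tick m j) : g_sigma_algebraType (G (upto j') (upto j')) -> R).
Proof.
move=> jj' jn; apply: (measurable_gridY BM) => [|i ij]; first exact/jN/(leq_trans jj').
by apply: leq_trans ij _; rewrite leq_mul2r jj' orbT.
Qed.

Let Gm I J E : <<s G I J >> E -> measurable E.
Proof. exact: (gridT_measurable BM). Qed.

Let mX' j : (j <= 2 * n)%N -> measurable_fun setT (X (tick m j)).
Proof. by have [+ _] := BM_measurable BM (tick m j). Qed.

Let mY' j : (j <= 2 * n)%N -> measurable_fun setT (Y (tick m j)).
Proof. by have [_ +] := BM_measurable BM (tick m j). Qed.

Let kill_past k j : (2 * k + 2 <= j)%N -> (j <= 2 * n)%N ->
  <<s G (upto j) (upto j) >> (kill m k).
Proof.
move=> kj jn.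
have k1 : (2 * k + 1 <= j)%N by apply: leq_trans kj; rewrite leq_add2l.
have k12 : ((2 * k + 1) * 2 ^ m + 2 ^ m = (2 * k + 2) * 2 ^ m)%N.
  by rewrite -mulSnr -addnS.
apply: (@measurableI _ (g_sigma_algebraType (G (upto j) (upto j)))).
  apply: (@measurableI _ (g_sigma_algebraType (G (upto j) (upto j)))).
    apply: (@measurableI _ (g_sigma_algebraType (G (upto j) (upto j)))).
      by rewrite -[X in _ X]setTI; exact: (mX k1 jn measurableT measurable_near_dash).
    apply: grid_within_measurable; first by rewrite k12; apply: jN; exact: leq_trans jn.
    by move=> i _; rewrite k12 => /leq_trans; apply; rewrite leq_mul2r kj orbT.
  by apply: measurable_gec; exact: mY.
by apply: measurable_lec; exact: mY.
Qed.

Let alive_past k j : (2 * k <= j)%N -> (j <= 2 * n)%N ->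
  <<s G (upto j) (upto j) >> (alive m k).
Proof.
move=> kj jn.
apply: (@measurable_forall_lt _ (g_sigma_algebraType (G (upto j) (upto j))) k
  (fun l => ~` kill m l)) => l lk.
apply: (@measurableC _ (g_sigma_algebraType (G (upto j) (upto j)))).
by apply: kill_past => //; apply: leq_trans kj; lia.
Qed.

Lemma alive_measurable k : (k <= n)%N -> measurable (alive m k).
Proof. by move=> kn; apply: Gm; apply: (@alive_past k (2 * k)%N) => //; rewrite leq_mul2l. Qed.

Let m_kill k : (k < n)%N -> measurable (kill m k).
Proof. by move=> kn; apply: Gm; apply: (@kill_past k (2 * k + 2)%N) => //; lia. Qed.

Let aliveS k : alive m k.+1 = alive m k `\` kill m k.
Proof.
apply/seteqP; split => w /=.
  by move=> H; split; [move=> l lk; apply: H; exact: ltnW|exact: (H k)].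
move=> [H nk] l; rewrite ltnS leq_eqVlt => /predU1P[-> //|]; exact: H.
Qed.

Lemma pr_aliveS k : (k < n)%N ->
  pr P (alive m k.+1) = pr P (alive m k) - pr P (alive m k `&` kill m k).
Proof.
move=> kn; have mA := alive_measurable (ltnW kn); have mK := m_kill kn.
have : pr P (alive m k) = pr P (alive m k `\` kill m k) + pr P (alive m k `&` kill m k).
  rewrite -prU; [|exact: measurableD|exact: measurableI|].
    by congr pr; rewrite setUC setUIDK.
  by rewrite setDE setIACA setICl setI0.
by rewrite aliveS => ->; rewrite addrK.
Qed.

(** * Change of the height during one block *)

Section step.
Variables (k : nat) (kn : (k < n)%N).
Variables (b M e B : R).
Hypothesis e0 : 0 < e.
Hypothesis b0 : 0 < b.
Hypothesis B0 : 0 <= B.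
Hypothesis lyap : forall y : R,
    (\int[normal_prob 0 (Num.sqrt (2 * dwell))]_z (`|y + z| `^ b)%:E + (drift M e b y)%:E
     <= (`|y| `^ b)%:E + B%:E * (\1_[set t : R | (`|t| < M)%R] y)%:E)%E.

Let Yk := Y (tick m (2 * k)).
Let Ak := alive m k.
Let W w := Y (tick m (2 * k + 2)) w - Y (tick m (2 * k)) w.

Let k2n : (2 * k <= 2 * n)%N. Proof. by rewrite leq_mul2l ltnW. Qed.
Let k22n : (2 * k + 2 <= 2 * n)%N. Proof. by lia. Qed.

Let mAk : measurable Ak. Proof. exact/alive_measurable/ltnW. Qed.

Let mYk : measurable_fun setT Yk. Proof. exact: mY'. Qed.

Let psi (y : R) : \bar R := (\int[normal_prob 0 (Num.sqrt (2 * dwell))]_z (`|y + z| `^ b)%:E)%E.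

Let W_law (y : R) : (\int[P]_w (`|y + W w| `^ b)%:E = psi y)%E.
Proof.
have mW : measurable_fun setT W by apply: measurable_funB; exact: mY'.
apply: (@integral_normal_law _ _ _ P (Num.sqrt (2 * dwell)) W mW) => //.
- move=> A mA.
  have s0 : 0 <= tick m (2 * k) by rewrite tmE mulr_ge0// ltW.
  have st : tick m (2 * k) < tick m (2 * k + 2).
    by rewrite !tmE ltr_pM2r// ltr_nat -{1}(addn0 (2 * k)%N) ltn_add2l.
  have := BM_lawY BM s0 st mA.
  by have -> : tick m (2 * k + 2) - tick m (2 * k) = 2 * dwell by rewrite !tmE natrD; lra.
- apply/measurable_EFinP; apply: measurableT_comp (measurable_normr_powR b) _.
  exact: measurable_funD.
Qed.

(** Being alive and Y at time 2k are past, the increment over the block is independent of them, so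
    [lyap] is applied pointwise and integrated. *)
Lemma killed_step_height :
  (\int[P]_w ((\1_Ak w)%:E * (`|Y (tick m (2 * k + 2)) w| `^ b)%:E) +
   \int[P]_w ((\1_Ak w)%:E * (drift M e b (Yk w))%:E) <=
   \int[P]_w ((\1_Ak w)%:E * (`|Yk w| `^ b)%:E) +
   B%:E * (pr P (Ak `&` [set w | (`|Yk w| < M)%R]))%:E)%E.
Proof.
have sAk : <<s G (upto (2 * k)) (upto (2 * k)) >> Ak by exact: alive_past.
(* The event enters as a real coordinate, so that [independent_fubini] freezes it together with the
   position. *)
pose U w : R * R := (\1_Ak w, Yk w).
have mU : measurable_fun setT (U : g_sigma_algebraType (G (upto (2 * k)) (upto (2 * k))) -> (R * R)%type).
  apply/measurable_fun_pair; last exact: mY.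
  exact: (@measurable_indic _ (g_sigma_algebraType (G (upto (2 * k)) (upto (2 * k)))) R setT Ak).
have mW : measurable_fun setT (W : g_sigma_algebraType (G set0 (from (2 * k))) -> R).
  apply: measurable_diff_gridY; [by rewrite leq_mul2r leq_addr orbT|exact: jN|].
  by [].
have ind : independent_systems P <<s G (upto (2 * k)) (upto (2 * k)) >> <<s G set0 (from (2 * k)) >>.
  by apply: (independent_grid BM) => //; rewrite setI0.
(* The absolute value makes [g] non-negative everywhere, as Tonelli requires; on an indicator it
   changes nothing. *)
pose g (z : (R * R) * R) : \bar R := (`|z.1.1| * `|z.1.2 + z.2| `^ b)%:E.
have g0 z : (0 <= g z)%E by rewrite lee_fin mulr_ge0 ?powR_ge0.
have mg : measurable_fun setT g.
  apply/measurable_EFinP; apply: measurable_funM.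
    apply: measurableT_comp; first exact: normr_measurable.
    by apply: measurableT_comp.
  apply: measurableT_comp (measurable_normr_powR b) _.
  by apply: measurable_funD => //; exact: measurableT_comp.
have fub := independent_fubini (@Gm _ _) (@Gm _ _) ind mU mW mg g0.
have i1 w : `|\1_Ak w| = \1_Ak w :> R by rewrite ger0_norm.
have -> : (\int[P]_w ((\1_Ak w)%:E * (`|Y (tick m (2 * k + 2)) w| `^ b)%:E) =
    \int[P]_w ((\1_Ak w)%:E * psi (Yk w)))%E.
  transitivity (\int[P]_w g (U w, W w))%E.
    apply: eq_integral => w _; rewrite /g /= i1 -EFinM; congr (_ * _ `^ _)%:E.
    by congr (`| _ |); rewrite /W /Yk addrC subrK.
  rewrite fub; apply: eq_integral => w _.
  rewrite -W_law -ge0_integralZl //.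
  - by apply: eq_integral => v _; rewrite /g /= i1 EFinM.
  - apply/measurable_EFinP; apply: measurableT_comp (measurable_normr_powR b) _.
    by apply: measurable_funD => //; apply: measurable_funB; exact: mY'.
have mA1 : measurable_fun setT (fun w => (\1_Ak w)%:E : \bar R).
  exact/measurable_EFinP/measurable_indic.
have n1 w : (0 <= (\1_Ak w)%:E :> \bar R)%E by rewrite lee_fin.
have psi0 y : (0 <= psi y)%E by apply: integral_ge0 => z _; rewrite lee_fin powR_ge0.
have mpsi : measurable_fun setT (fun w => psi (Yk w)).
  have mf : measurable_fun setT (fun z : R * R => (`|z.1 + z.2| `^ b)%:E).
    apply/measurable_EFinP; apply: measurableT_comp (measurable_normr_powR b) _.
    exact: measurable_funD.
  have f0 (z : R * R) : (0 <= (`|z.1 + z.2| `^ b)%:E)%E by rewrite lee_fin powR_ge0.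
  have := @measurable_fun_fubini_tonelli_F _ _ _ _ R (normal_prob 0 (Num.sqrt (2 * dwell)))
    (fun z : R * R => (`|z.1 + z.2| `^ b)%:E) mf f0.
  by move=> mF; exact: (measurableT_comp mF mYk).
have mdr : measurable_fun setT (fun w => (drift M e b (Yk w))%:E).
  apply/measurable_EFinP; apply: measurableT_comp mYk; exact: measurable_drift.
have mY1 : measurable_fun setT (fun w => (`|Yk w| `^ b)%:E).
  apply/measurable_EFinP; exact: (measurableT_comp (measurable_normr_powR b) mYk).
have dr0 w : (0 <= (drift M e b (Yk w))%:E)%E by rewrite lee_fin drift_ge0// ltW.
pose Q := Ak `&` [set w | `|Yk w| < M].
have mQ : measurable Q.
  apply: measurableI => //; rewrite (_ : [set w | `|Yk w| < M] = ~` [set w | M <= `|Yk w|]).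
    apply: measurableC; apply: measurable_gec; apply: measurableT_comp mYk.
    exact: normr_measurable.
  by apply/seteqP; split => w /=; rewrite ltNge => /negP.
have mp1 := emeasurable_funM mA1 mpsi; have md1 := emeasurable_funM mA1 mdr.
have my1 := emeasurable_funM mA1 mY1.
have p1 w (_ : setT w) := mule_ge0 (n1 w) (psi0 (Yk w)).
have d1 w (_ : setT w) := mule_ge0 (n1 w) (dr0 w).
have y1 w (_ : setT w) : (0 <= (\1_Ak w)%:E * (`|Yk w| `^ b)%:E)%E.
  by apply: mule_ge0 => //; rewrite lee_fin powR_ge0.
have mQ1 : measurable_fun setT (fun w => B%:E * (\1_Q w)%:E)%E.
  by apply: emeasurable_funM => //; exact/measurable_EFinP/measurable_indic.
have q1 w (_ : setT w) : (0 <= B%:E * (\1_Q w)%:E)%E by apply: mule_ge0; rewrite lee_fin.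
rewrite -(ge0_integralD P measurableT p1 mp1 d1 md1).
have -> : (B%:E * (pr P Q)%:E = \int[P]_w (B%:E * (\1_Q w)%:E))%E.
  rewrite -integral_pr_indic// ge0_integralZl//.
  exact/measurable_EFinP/measurable_indic.
rewrite -(ge0_integralD P measurableT y1 my1 q1 mQ1).
apply: le_integral_nonneg => w; first by apply: adde_ge0; [exact: p1|exact: d1].
rewrite [in leRHS]indicE [in leLHS]indicE.
case: (boolP (w \in Ak)) => Aw; rewrite ?mul1e ?mul0e ?add0e; last exact: q1.
apply: (le_trans (lyap (Yk w))); rewrite leeD2l// lee_wpmul2l// lee_fin !indicE ler_nat.
case: (boolP (Yk w \in _)) => // YM; rewrite mem_set//; split; first by rewrite inE in Aw.
by rewrite inE in YM.
Qed.

End step.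

(** * Probability of a crossing during one block *)

Section hit.
Variables (k : nat) (kn : (k < n)%N) (M : R).
Hypothesis M0 : 0 < M.

Let Yk := Y (tick m (2 * k)).
Let Xk := X (tick m (2 * k)).
Let Ak := alive m k.
Let DX w := X (tick m (2 * k + 1)) w - Xk w.
Let DY w := Y (tick m (2 * k + 1)) w - Yk w.
Let osc := [set w | forall i, (i < (2 ^ m).+1)%N ->
  `|X (((2 * k + 1) * 2 ^ m + i)%:R * mesh m) w - X (((2 * k + 1) * 2 ^ m)%:R * mesh m) w| <= r / 2].
Let down := [set w | Y (tick m (2 * k + 2)) w - Y (tick m (2 * k + 1)) w <= - 1].
(** With Y in [0, 1] at the middle of the block, a later fall by 1 forces the change of sign. *)
Let aim := Ak `&` [set w | near_dash (X (tick m (2 * k + 1)) w)] `&`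
  [set w | 0 <= Y (tick m (2 * k + 1)) w] `&` [set w | Y (tick m (2 * k + 1)) w <= 1].

Let k2n : (2 * k <= 2 * n)%N. Proof. by rewrite leq_mul2l ltnW. Qed.
Let k21n : (2 * k + 1 <= 2 * n)%N. Proof. by lia. Qed.
Let k22n : (2 * k + 2 <= 2 * n)%N. Proof. by lia. Qed.

Let s_aim : <<s G (upto (2 * k + 1)) (upto (2 * k + 1)) >> aim.
Proof.
apply: (@measurableI _ (g_sigma_algebraType (G (upto (2 * k + 1)) (upto (2 * k + 1))))).
  apply: (@measurableI _ (g_sigma_algebraType (G (upto (2 * k + 1)) (upto (2 * k + 1))))).
    apply: (@measurableI _ (g_sigma_algebraType (G (upto (2 * k + 1)) (upto (2 * k + 1))))).
      by apply: alive_past => //; exact: leq_addr.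
    rewrite -[X in _ X]setTI.
    exact: (mX (leqnn _) k21n measurableT measurable_near_dash).
  by apply: measurable_gec; exact: mY.
by apply: measurable_lec; exact: mY.
Qed.

Let s_osc : <<s G (from (2 * k + 1)) set0 >> osc.
Proof.
apply: grid_within_measurable => //.
by rewrite -mulSnr -addnS; apply: jN.
Qed.

Let s_down : <<s G set0 (from (2 * k + 1)) >> down.
Proof.
apply: (@measurable_lec R _ (g_sigma_algebraType (G set0 (from (2 * k + 1))))).
apply: measurable_diff_gridY => //; last exact: jN.
by rewrite leq_mul2r leq_add2l orbT.
Qed.

Let aim_osc_down : aim `&` (osc `&` down) `<=` Ak `&` kill m k.
Proof.
move=> w [[[[Aw nw] y0] y1] [ow dw]]; split => //; split => //=.
by move: y1 dw; rewrite /down /=; lra.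
Qed.

Let g := normal_prob 0 (Num.sqrt dwell).

Let law1 (A C : set R) (j : nat) : measurable A -> measurable C ->
  pr P [set w | A (X (tick m (j + 1)) w - X (tick m j) w) /\
                C (Y (tick m (j + 1)) w - Y (tick m j) w)] = pr g A * pr g C.
Proof.
move=> mA mC.
have s0 : 0 <= tick m j by rewrite tmE mulr_ge0// ltW.
have st : tick m j < tick m (j + 1).
  by rewrite !tmE ltr_pM2r// ltr_nat -{1}(addn0 j) ltn_add2l.
have := BM_increment_law BM s0 st mA mC.
by have -> : tick m (j + 1) - tick m j = dwell by rewrite !tmE natrD; lra.
Qed.

Let pr_osc : 1 / 2 <= pr P osc.
Proof.
have r20 : 0 < r / 2 by rewrite divr_gt0.
have := @BM_pr_within _ _ _ P a X Y BM (mesh m) N (eta0 m) (r / 2) ((2 * k + 1) * 2 ^ m) (2 ^ m) r20.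
rewrite expn_gt0 => /(_ isT); rewrite -mulSnr -addnS => /(_ (jN k22n)).
apply: le_trans.
have -> : (2 ^ m)%:R * mesh m = dwell by have := tmE m 1; rewrite /tick mul1n mul1r.
have -> : 1024 * dwell ^+ 2 / (r / 2) ^+ 4 = 1 / 4 by rewrite /dwell; field; rewrite gt_eqF.
lra.
Qed.

Let pr_down : pr P down = pr g [set z | z <= - 1].
Proof.
have m1 : measurable [set z : R | z <= - 1] by exact: measurable_lec.
have := law1 (2 * k + 1) measurableT m1; rewrite prT mul1r -addnA => <-.
by congr pr; apply/seteqP; split => w //= [].
Qed.

(** Product of two bounds from [normal_prob_itv_ge]: length r inside [-(x + r), x + r] for X, length
    1 inside [-(M + 1), M + 1] for Y. *)
Let d1 : R := (r * normal_pdf 0 (Num.sqrt dwell) (x + r)) * normal_pdf 0 (Num.sqrt dwell) (M + 1).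

Let d10 : 0 <= d1.
Proof. by apply: mulr_ge0; [apply: mulr_ge0; [exact: ltW|exact: normal_pdf_ge0]|exact: normal_pdf_ge0]. Qed.

Let hn0 : Num.sqrt dwell != 0. Proof. by rewrite gt_eqF// sqrtr_gt0. Qed.

Let itv_ge (K u v : R) : - K <= u -> u <= v -> v <= K ->
  (v - u) * normal_pdf 0 (Num.sqrt dwell) K <= pr g `[u, v].
Proof.
move=> Ku uv vK; have := normal_prob_itv_ge hn0 Ku uv vK.
by rewrite (prE g)// lee_fin.
Qed.

(** The centre of the dash with index floor(x1 / x) lies less than x to the left of x1, so the
    displacements of X that reach its inner half contain an interval of length r inside
    [-(x + r), x + r], whatever x1 is. *)
Let aim_from (x1 y1 : R) : `|y1| < M ->
  d1 <= pr P [set w | near_dash (x1 + DX w) /\ (0 <= y1 + DY w) /\ (y1 + DY w <= 1)].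
Proof.
move=> yM.
pose z := Num.floor (x1 / x).
have /andP[z1 z2] := floor_itv (x1 / x); rewrite -/z in z1 z2.
rewrite ler_pdivlMr// in z1; rewrite ltr_pdivrMr// in z2.
rewrite intrD mulrDl mul1r in z2.
pose al := z%:~R * x - x1 - r / 2.
move: yM; rewrite ltr_norml => /andP[yM1 yM2].
have rr := r0; have xx := x0; have MM := M0.
have al1 : - (x + r) <= al by rewrite /al; lra.
have al2 : al <= al + r by lra.
have al3 : al + r <= x + r by rewrite /al; lra.
have h1 := itv_ge al1 al2 al3.
have be1 : - (M + 1) <= - y1 by lra.
have be2 : - y1 <= - y1 + 1 by lra.
have be3 : - y1 + 1 <= M + 1 by lra.
have h2 := itv_ge be1 be2 be3.
have p1 := normal_pdf_ge0 0 (Num.sqrt dwell) (x + r); have p2 := normal_pdf_ge0 0 (Num.sqrt dwell) (M + 1).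
have h3 : d1 <= pr g `[al, al + r] * pr g `[- y1, - y1 + 1].
  apply: (@le_trans _ _ (((al + r - al) * normal_pdf 0 (Num.sqrt dwell) (x + r)) *
     ((- y1 + 1 - (- y1)) * normal_pdf 0 (Num.sqrt dwell) (M + 1)))).
    by rewrite /d1; lra.
  by apply: ler_pM => //; apply: mulr_ge0 => //; lra.
apply: (le_trans h3); rewrite -(law1 (2 * k))//.
have mDX : measurable_fun setT DX by apply: measurable_funB; exact: mX'.
have mDY : measurable_fun setT DY by apply: measurable_funB; exact: mY'.
apply: pr_le.
- have m1 := mDX measurableT _ (measurable_itv `[al, al + r]).
  have m2 := mDY measurableT _ (measurable_itv `[- y1, - y1 + 1]).
  by have := measurableI _ _ m1 m2; rewrite !setTI.
- have m1 : measurable [set w | near_dash (x1 + DX w)].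
    rewrite -[X in measurable X]setTI.
    exact: ((measurable_funD (measurable_cst x1) mDX) measurableT _ measurable_near_dash).
  have m2 : measurable [set w | 0 <= y1 + DY w].
    by apply: measurable_gec; exact: measurable_funD.
  have m3 : measurable [set w | y1 + DY w <= 1].
    by apply: measurable_lec; exact: measurable_funD.
  exact: measurableI m1 (measurableI _ _ m2 m3).
- move=> w; rewrite /= !in_itv/= => -[/andP[a1 a2] /andP[b1 b2]]; split; last first.
    by rewrite /DY /Yk; split; lra.
  apply/near_dashP; exists z; rewrite ler_norml /DX /Xk; apply/andP; split;
    move: a1 a2; rewrite /al; lra.
Qed.

(** Markov property at time 2k: [aim_from] holds for every frozen position in the band and is
    integrated over the past. *)
Let pr_aim : d1 * pr P (Ak `&` [set w | `|Yk w| < M]) <= pr P aim.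
Proof.
pose Q := Ak `&` [set w | `|Yk w| < M].
have mAk : measurable Ak by exact/alive_measurable/ltnW.
have mQ : measurable Q.
  apply: measurableI => //; rewrite (_ : [set w | `|Yk w| < M] = ~` [set w | M <= `|Yk w|]).
    apply: measurableC; apply: measurable_gec; apply: measurableT_comp; last exact: mY'.
    exact: normr_measurable.
  by apply/seteqP; split => w /=; rewrite ltNge => /negP.
have sAk : <<s G (upto (2 * k)) (upto (2 * k)) >> Ak by exact: alive_past.
pose U w : R * (R * R) := (\1_Ak w, (Xk w, Yk w)).
pose W w : R * R := (DX w, DY w).
have mU : measurable_fun setT (U : g_sigma_algebraType (G (upto (2 * k)) (upto (2 * k))) -> (R * (R * R))%type).
  apply/measurable_fun_pair.
    exact: (@measurable_indic _ (g_sigma_algebraType (G (upto (2 * k)) (upto (2 * k)))) R setT Ak).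
  by apply/measurable_fun_pair; [exact: mX|exact: mY].
have mW : measurable_fun setT (W : g_sigma_algebraType (G (from (2 * k)) (from (2 * k))) -> (R * R)%type).
  apply/measurable_fun_pair.
    by apply: measurable_diff_gridX; [rewrite leq_mul2r leq_addr orbT|exact: jN|].
  by apply: measurable_diff_gridY; [rewrite leq_mul2r leq_addr orbT|exact: jN|].
have ind : independent_systems P <<s G (upto (2 * k)) (upto (2 * k)) >>
    <<s G (from (2 * k)) (from (2 * k)) >>.
  by apply: (independent_grid BM).
(* The first coordinate of [U] is an indicator, so [1 <= z.1.1] means being alive. *)
pose S : set ((R * (R * R)) * (R * R)) := [set z | 1 <= z.1.1] `&`
  [set z | near_dash (z.1.2.1 + z.2.1)] `&` [set z | 0 <= z.1.2.2 + z.2.2] `&`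
  [set z | z.1.2.2 + z.2.2 <= 1].
have mS : measurable S.
  apply: measurableI; [apply: measurableI; [apply: measurableI|]|].
  - by apply: measurable_gec; exact: measurableT_comp.
  - rewrite -[X in measurable X]setTI.
    have mf : measurable_fun setT (fun z : (R * (R * R)) * (R * R) => z.1.2.1 + z.2.1).
      by apply: measurable_funD; do 2?[apply: measurableT_comp => //].
    exact: (mf measurableT _ measurable_near_dash).
  - by apply: measurable_gec; apply: measurable_funD; do 2?[apply: measurableT_comp => //].
  - by apply: measurable_lec; apply: measurable_funD; do 2?[apply: measurableT_comp => //].
have mg : measurable_fun setT (fun z => (\1_S z)%:E : \bar R).
  exact/measurable_EFinP/measurable_indic.
have g0 z : (0 <= (\1_S z)%:E :> \bar R)%E by rewrite lee_fin.
have fub := independent_fubini (@Gm _ _) (@Gm _ _) ind mU mW mg g0.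
rewrite -lee_fin EFinM -integral_pr_indic// -integral_pr_indic; last exact: Gm s_aim.
rewrite -ge0_integralZl//; last exact/measurable_EFinP/measurable_indic.
have -> : (\int[P]_w (\1_aim w)%:E = \int[P]_w (\1_S (U w, W w))%:E)%E.
  apply: eq_integral => w _; congr ((nat_of_bool _)%:R)%:E.
  apply/idP/idP; rewrite !inE.
    move=> [[[Aw nw] y0] y1]; split; [split; [split|]|] => /=.
    - by rewrite indicE mem_set.
    - by rewrite /DX /Xk addrC subrK.
    - by rewrite /DY /Yk addrC subrK.
    - by rewrite /DY /Yk addrC subrK.
  move=> [[[/= Aw nw] y0] y1]; split; [split; [split|]|] => /=.
  - by move: Aw; rewrite indicE; case: (boolP (w \in Ak)); rewrite ?inE// ler10.
  - by move: nw; rewrite /DX /Xk addrC subrK.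
  - by move: y0; rewrite /DY /Yk addrC subrK.
  - by move: y1; rewrite /DY /Yk addrC subrK.
rewrite fub.
apply: le_integral_nonneg => w; first by rewrite -EFinM lee_fin mulr_ge0.
rewrite indicE; case: (boolP (w \in Q)); rewrite ?inE => Qw; last first.
  by rewrite mule0; apply: integral_ge0 => v _; rewrite lee_fin.
rewrite mule1; have [Aw yM] := Qw.
have mE : measurable [set v | near_dash (Xk w + DX v) /\
    (0 <= Yk w + DY v) /\ (Yk w + DY v <= 1)].
  have mDX : measurable_fun setT DX by apply: measurable_funB; exact: mX'.
  have mDY : measurable_fun setT DY by apply: measurable_funB; exact: mY'.
  have m1 : measurable [set v | near_dash (Xk w + DX v)].
    rewrite -[X in measurable X]setTI.
    exact: ((measurable_funD (measurable_cst (Xk w)) mDX) measurableT _ measurable_near_dash).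
  have m2 : measurable [set v | 0 <= Yk w + DY v].
    by apply: measurable_gec; exact: measurable_funD.
  have m3 : measurable [set v | Yk w + DY v <= 1].
    by apply: measurable_lec; exact: measurable_funD.
  exact: measurableI m1 (measurableI _ _ m2 m3).
apply: (@le_trans _ _ (pr P [set v | near_dash (Xk w + DX v) /\
    (0 <= Yk w + DY v) /\ (Yk w + DY v <= 1)])%:E).
  by rewrite lee_fin; apply: aim_from.
rewrite -integral_pr_indic//; apply: le_integral_nonneg => v; first by rewrite lee_fin.
rewrite lee_fin !indicE ler_nat; case: (boolP (v \in _)) => //; rewrite inE => -[nv [v0 v1]].
rewrite mem_set//; split; [split; [split|]|] => //=.
by rewrite indicE mem_set.
Qed.

(** In the second half of the block, the oscillation of X and the fall of Y are independent of each
    other and of [aim]; they contribute 1/2 and the mass of z <= -1. *)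
Lemma killed_step_prob :
  d1 * (1 / 2) * pr g [set z | z <= - 1] * pr P (Ak `&` [set w | `|Yk w| < M])
  <= pr P (Ak `&` kill m k).
Proof.
have mAk : measurable Ak by exact/alive_measurable/ltnW.
have ms1 := Gm s_aim; have ms2 := Gm s_osc; have ms3 := Gm s_down.
apply: (@le_trans _ _ (pr P (aim `&` (osc `&` down)))); last first.
  apply: pr_le aim_osc_down; first exact: (measurableI _ _ ms1 (measurableI _ _ ms2 ms3)).
  by apply: measurableI => //; exact: m_kill.
have -> : pr P (aim `&` (osc `&` down)) = pr P aim * (pr P osc * pr P down).
  have <- : pr P (osc `&` down) = pr P osc * pr P down.
    by apply: (independent_grid BM (eta0 m) _ _ s_osc s_down); rewrite ?setI0 ?set0I.
  apply: (independent_grid BM (eta0 m) (upto_from (2 * k + 1)) (upto_from (2 * k + 1)) s_aim).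
  apply: (@measurableI _ (g_sigma_algebraType (G (from (2 * k + 1)) (from (2 * k + 1))))).
    apply: grid_within_measurable => //.
    by rewrite -mulSnr -addnS; apply: jN.
  apply: (@measurable_lec R _ (g_sigma_algebraType (G (from (2 * k + 1)) (from (2 * k + 1))))).
  apply: measurable_diff_gridY => //; last exact: jN.
  by rewrite leq_mul2r leq_add2l orbT.
rewrite pr_down.
have q0 := pr_ge0 g [set z | z <= - 1]; have := pr_osc; have := pr_aim.
set u := pr P (Ak `&` _); set v := pr P aim; set o := pr P osc; set q := pr g _ in q0 *.
move=> h1 h2.
have u0 : 0 <= d1 * u by apply: mulr_ge0 => //; exact: pr_ge0.
have h3 : d1 * u * (1 / 2) <= v * o by apply: ler_pM => //; lra.
by have := ler_wpM2r q0 h3; lra.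
Qed.

End hit.
End fixed.

Let measurable_alive m n : measurable (alive m n).
Proof. exact: (@alive_measurable m n n). Qed.

Let alive0 m : alive m 0 = setT.
Proof. by apply/seteqP; split. Qed.

Let aliveS_sub m n : alive m n.+1 `<=` alive m n.
Proof. by move=> w H k kn; apply: H; exact: ltnW. Qed.

(** [K] is chosen before [m]: nothing in the drift or crossing bounds depends on the mesh, so the
    tail survives refinement. *)
Lemma alive_tail (b : R) : 1 / 2 < b -> b < 1 -> exists2 K : R, 0 <= K &
  forall m n : nat, (0 < n)%N -> pr P (alive m n) <= K / Num.sqrt n%:R `^ b.
Proof.
move=> b1 b2; have b0 : 0 < b by lra.
have hh0 : 0 < Num.sqrt (2 * dwell) by rewrite sqrtr_gt0 mulr_gt0.
have [M [e [B [M1 e0 e1 B0 lyap]]]] := normal_lyapunov hh0 b1 b2.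
have M0 : 0 < M by lra.
have sh0 : Num.sqrt dwell != 0 by rewrite gt_eqF// sqrtr_gt0.
have pdf0 z : 0 < normal_pdf 0 (Num.sqrt dwell) z.
  by rewrite normal_pdf0E// mulr_gt0 ?expR_gt0//; exact: normal_peak_gt0.
set q := pr (normal_prob 0 (Num.sqrt dwell)) [set z | z <= - 1].
have q0 : 0 < q.
  have : 0 < pr (normal_prob 0 (Num.sqrt dwell)) `[- 2, - 1].
    rewrite -lte_fin -(prE (normal_prob 0 (Num.sqrt dwell)))//.
    by apply: normal_prob_itv_gt0 => //; lra.
  move=> /lt_le_trans; apply; apply: pr_le => //; first exact: measurable_lec.
  by move=> z /=; rewrite in_itv/= => /andP[].
pose dl := r * normal_pdf 0 (Num.sqrt dwell) (x + r) * normal_pdf 0 (Num.sqrt dwell) (M + 1) * (1 / 2) * q.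
have dl0 : 0 < dl by rewrite /dl !mulr_gt0.
(* A visit to the band costs at most [B] in height and is killed with probability at least [dl], so
   killing pays at the rate B / dl. *)
pose C := B / dl; have C0 : 0 <= C by rewrite divr_ge0// ltW.
pose K1 := (`|a.2| `^ b + C) * (1 + e^-1).
have K10 : 0 <= K1 by rewrite mulr_ge0// addr_ge0 ?powR_ge0// invr_ge0 ltW.
exists (K1 + M `^ b); first by rewrite addr_ge0// powR_ge0.
move=> m n n0.
have nR : 0 < n%:R :> R by rewrite ltr0n.
set L := Num.sqrt n%:R.
have L0 : 0 < L by rewrite sqrtr_gt0.
have Lb : 0 < L `^ b by exact: powR_gt0.
(* For sqrt n < M the trivial bound 1 <= M^b / L^b suffices; this is the term M^b in the
   constant. *)
have [LM|ML] := ltrP L M.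
  apply: (le_trans (pr_le1 P (measurable_alive m n))).
  rewrite ler_pdivlMr// mul1r; apply: (@le_trans _ _ (M `^ b)); last by rewrite lerDr.
  by apply: ge0_ler_powR; rewrite ?nnegrE//; exact: ltW.
pose Z k := Y (tick m (2 * k)).
have mZ k : measurable_fun setT (Z k) by have [_] := BM_measurable BM (tick m (2 * k)).
pose H k := (\int[P]_w ((\1_(alive m k) w)%:E * (`|Z k w| `^ b)%:E))%E.
pose D k := (\int[P]_w ((\1_(alive m k) w)%:E * (drift M e b (Z k w))%:E))%E.
pose Q k := pr P (alive m k `&` [set w | `|Z k w| < M]).
have H0 k : (0 <= H k)%E.
  by apply: integral_ge0 => w _; rewrite -EFinM lee_fin mulr_ge0 ?powR_ge0.
have D0 k : (0 <= D k)%E.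
  by apply: integral_ge0 => w _; rewrite -EFinM lee_fin mulr_ge0 ?drift_ge0// ltW.
have stepE k : (k < n)%N -> (H k.+1 + D k <= H k + (B * Q k)%:E)%E.
  move=> kn; rewrite EFinM; apply: le_trans (killed_step_height m kn e0 b0 B0 lyap).
  apply: leeD; last exact: lexx.
  apply: le_integral_nonneg => w.
    by rewrite -EFinM lee_fin mulr_ge0 ?powR_ge0.
  rewrite /Z (_ : 2 * k.+1 = 2 * k + 2)%N; last by rewrite mulnS addnC.
  apply: lee_wpmul2r; first by rewrite lee_fin powR_ge0.
  rewrite lee_fin !indicE ler_nat; case: (boolP (w \in alive m k.+1)) => //.
  by rewrite inE => /aliveS_sub Aw; rewrite mem_set.
have H0E : H 0%N = (`|a.2| `^ b)%:E.
  rewrite /H alive0; have [_ B00 _ _] := BM.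
  transitivity (\int[P]_w (`|a.2| `^ b)%:E)%E.
    apply: eq_integral => w _; rewrite indicT mul1e /Z /tick muln0 mul0n mul0r.
    by have [_ ->] := B00 w.
  transitivity ((`|a.2| `^ b)%:E * P setT)%E; first exact: (integral_cst P measurableT (`|a.2| `^ b)%:E).
  by rewrite (prE P measurableT) prT mule1.
(* Finiteness propagates along the step inequality from the deterministic starting height. *)
have Hfin k : (k <= n)%N -> H k \is a fin_num.
  elim: k => [_|k IH kn]; first by rewrite H0E.
  rewrite ge0_fin_numE//; apply: (@le_lt_trans _ _ (H k.+1 + D k)%E); first by rewrite leeDl.
  apply: (le_lt_trans (stepE k kn)); rewrite -(fineK (IH (ltnW kn))) -EFinD; exact: ltry.
have Dfin k : (k < n)%N -> D k \is a fin_num.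
  move=> kn; rewrite ge0_fin_numE//.
  apply: (@le_lt_trans _ _ (H k.+1 + D k)%E); first by rewrite leeDr.
  apply: (le_lt_trans (stepE k kn)); rewrite -(fineK (Hfin k (ltnW kn))) -EFinD; exact: ltry.
have := @lyapunov_tail R (fun k => fine (H k)) (fun k => fine (D k))
  (fun k => pr P (alive m k)) n C e b n0 e0 C0.
rewrite H0E -/K1 -/L => tail.
have : pr P (alive m n) <= K1 / L `^ b.
  apply: tail.
  - by move=> k; apply: fine_ge0.
  - by move=> k; apply: fine_ge0.
  - by move=> k; exact: pr_ge0.
  - by rewrite alive0 prT.
  - by move=> k; apply: pr_le => //; exact: aliveS_sub.
  - move=> k kn.
    have stepR : fine (H k.+1) + fine (D k) <= fine (H k) + B * Q k.
      exact: (fine_leD (Hfin _ kn) (Dfin _ kn) (Hfin _ (ltnW kn)) (stepE k kn)).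
    apply: (le_trans stepR); rewrite lerD2l.
    have -> : pr P (alive m k) - pr P (alive m k.+1) = pr P (alive m k `&` kill m k).
      have -> := pr_aliveS m kn; ring.
    have := killed_step_prob m kn M0; rewrite -/q -/dl -/(Q k) => hk.
    by rewrite /C mulrAC ler_pdivlMr// mulrAC -mulrA ler_wpM2l// mulrC.
  - move=> k kn; have kn' := ltnW kn.
    rewrite -lee_fin EFinD !EFinM (fineK (Hfin _ kn')) (fineK (Dfin _ kn)) -EFinM.
    have c1 : (0 <= ((L `^ b)^-1)%:E :> \bar R)%E by rewrite lee_fin invr_ge0 powR_ge0.
    have c2 : (0 <= (L `^ (2 - b) / e)%:E :> \bar R)%E by rewrite lee_fin divr_ge0 ?powR_ge0// ltW.
    have mA1 : measurable_fun setT (fun w => (\1_(alive m k) w)%:E : \bar R).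
      exact/measurable_EFinP/measurable_indic.
    have n1 w : (0 <= (\1_(alive m k) w)%:E :> \bar R)%E by rewrite lee_fin.
    have mh : measurable_fun setT (fun w => ((\1_(alive m k) w)%:E * (`|Z k w| `^ b)%:E)%E).
      apply: emeasurable_funM => //; apply/measurable_EFinP.
      exact: (measurableT_comp (measurable_normr_powR b) (mZ k)).
    have md : measurable_fun setT (fun w => ((\1_(alive m k) w)%:E * (drift M e b (Z k w))%:E)%E).
      apply: emeasurable_funM => //; apply/measurable_EFinP.
      exact: (measurableT_comp (measurable_drift M e b) (mZ k)).
    have h0' w (_ : setT w) : (0 <= (\1_(alive m k) w)%:E * (`|Z k w| `^ b)%:E)%E.
      by apply: mule_ge0 => //; rewrite lee_fin powR_ge0.
    have d0' w (_ : setT w) : (0 <= (\1_(alive m k) w)%:E * (drift M e b (Z k w))%:E)%E.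
      by apply: mule_ge0 => //; rewrite lee_fin drift_ge0// ltW.
    have mh1 := emeasurable_funM (measurable_cst ((L `^ b)^-1)%:E) mh.
    have md1 := emeasurable_funM (measurable_cst (L `^ (2 - b) / e)%:E) md.
    have h1 w (Tw : setT w) := mule_ge0 c1 (h0' w Tw).
    have d1 w (Tw : setT w) := mule_ge0 c2 (d0' w Tw).
    rewrite muleC [X in (_ + X)%E]muleC.
    rewrite -(ge0_integralZl P measurableT mh h0' c1) -(ge0_integralZl P measurableT md d0' c2).
    rewrite -(ge0_integralD P measurableT h1 mh1 d1 md1) -integral_pr_indic//.
    apply: le_integral_nonneg => // w; rewrite indicE.
    case: (boolP (w \in alive m k)) => _; last by rewrite !mul0e !mule0 adde0.
    rewrite !mul1e -!EFinM -EFinD lee_fin.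
    apply: (le_trans (@drift_split R M e b L (Z k w) M1 ML e0 e1 b0 b2)); lra.
move=> /le_trans; apply; rewrite ler_pM2r ?invr_gt0// lerDl; exact: powR_ge0.
Qed.

(** Refinement adds oscillation conditions and leaves the block times unchanged; so [kill] decreases
    and [alive] increases with [m]. *)
Let killS m k : kill m.+1 k `<=` kill m k.
Proof.
move=> w [[[H1 H2] H3] H4]; split; [split; [split|]|] => /=.
- by move: H1; rewrite /= !tmE.
- have dbl j i : (j * 2 ^ m + i)%:R * mesh m = (j * 2 ^ m.+1 + i * 2)%:R * mesh m.+1.
    rewrite /mesh expnS !natrD !natrM; field.
    have p2 : (2 ^ m)%:R != 0 :> R by rewrite pnatr_eq0 -lt0n expn_gt0.
    by rewrite -mulr2n mulrn_eq0 p2.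
  move=> i i_n; rewrite dbl -[X in X%:R * mesh m]addn0 dbl mul0n addn0.
  by apply: H2; rewrite ltnS expnS mulnC leq_mul2l -ltnS i_n orbT.
- by move: H3; rewrite /= !tmE.
- by move: H4; rewrite /= !tmE.
Qed.

(** When the conditions hold at every mesh, continuity keeps X within r / 2 + r / 2 of a dash centre
    during the whole second half of the block, and Y vanishes there by the intermediate value
    theorem. *)
Let kill_exit w k : (forall m, kill m k w) ->
  (exit_time (dashed_domain x r) X Y w <= ((2 * k + 2)%:R * dwell)%:E)%E.
Proof.
move=> H; have [_ _ cXY _] := BM; have [cX cY] := cXY w.
set t1 := (2 * k + 1)%:R * dwell; set t2 := (2 * k + 2)%:R * dwell.
have t10 : 0 <= t1 by rewrite mulr_ge0// ltW.
have t2E : t2 = t1 + dwell by rewrite /t1 /t2 !natrD; lra.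
have t12 : t1 <= t2 by rewrite t2E lerDl ltW.
(* The conditions at block times are the same for all meshes, so mesh 0 supplies them. *)
have [[[H1 _] H3] H4] := H 0%N; rewrite /= !tmE -/t1 -/t2 in H1 H3 H4.
have cXw : {within [set t : R | 0 <= t], continuous (fun t => - X t w)}.
  by move=> t; apply: cvgN; exact: cX.
have gridE m i : ((2 * k + 1) * 2 ^ m + i)%:R * mesh m = t1 + i%:R * (dwell / (2 ^ m)%:R).
  by rewrite natrD mulrDl -/(tick m (2 * k + 1)) tmE.
have osc m i : (i <= 1 * 2 ^ m)%N -> `|X (t1 + i%:R * (dwell / (2 ^ m)%:R)) w - X t1 w| <= r / 2.
  rewrite mul1n -ltnS => i_n; have [[[_ H2] _] _] := H m.
  by have := H2 i i_n; rewrite gridE -/(tick m (2 * k + 1)) tmE.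
have Xosc u : t1 <= u -> u <= t2 -> `|X u w - X t1 w| <= r / 2.
  move=> u1 u2; have u2' : u <= t1 + 1%:R * dwell by rewrite mul1r -t2E.
  have a1 : X t1 w - r / 2 <= X u w.
    apply: (@dyadic_dense_ge R (fun t => X t w) _ t1 dwell 1) => // m i i_n.
    by have := osc m i i_n; rewrite ler_norml; lra.
  have a2 : - X t1 w - r / 2 <= - X u w.
    apply: (@dyadic_dense_ge R (fun t => - X t w) _ t1 dwell 1) => // m i i_n.
    by have := osc m i i_n; rewrite ler_norml; lra.
  by rewrite ler_norml; apply/andP; split; lra.
have cYi : {within `[t1, t2], continuous (fun t => Y t w)}.
  apply: continuous_subspaceW cY => t /=; rewrite in_itv/= => /andP[tt _].
  exact: le_trans tt.
have Y0 : Num.min (Y t1 w) (Y t2 w) <= 0 <= Num.max (Y t1 w) (Y t2 w).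
  by rewrite ge_min le_max H3 H4 orbT.
have [u] := IVT t12 cYi Y0; rewrite in_itv/= => /andP[u1 u2] Yu.
apply: (@le_trans _ _ u%:E); last by rewrite lee_fin.
apply: exit_time_le; first exact: le_trans u1.
move=> /=; apply; split=> //.
have [z Hz] := (near_dashP _).1 H1; exists z.
have := Xosc u u1 u2; rewrite !ler_norml in Hz *; move: Hz => /andP[z1 z2] /andP[z3 z4].
by rewrite /=; apply/andP; split; lra.
Qed.

Lemma dashed_moment_finite (p : R) : 0 < p -> p < 1 / 2 ->
  (\int[P]_w (poweR (exit_time (dashed_domain x r) X Y w) p) < +oo)%E.
Proof.
move=> p0 p2.
(* With b = p + 1/2, the requirement p < b / 2 reads p < 1/2. *)
have [K K0 tail] := @alive_tail (p + 1 / 2) ltac:(lra) ltac:(lra).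
have mU n : measurable (\bigcup_m alive m n) by exact: bigcupT_measurable.
have k0 : 0 < 2 * dwell by rewrite mulr_gt0.
apply: (@moment_finite _ _ _ P _ (fun n => \bigcup_m alive m n) K (2 * dwell) (p + 1 / 2) p) => //.
- lra.
- by move=> w; exact: exit_time_ge0.
- move=> n n0; apply: pr_bigcup_le => // [m w Aw k kn|m]; last exact: tail.
  by move=> /killS; exact: Aw.
- move=> n w nt.
  (* Each of the n blocks fails to kill at some mesh, since otherwise the exit would come too early;
     monotonicity then gives one mesh for all n blocks. *)
  have nk k : (k < n)%N -> exists m, ~ kill m k w.
    move=> kn; apply/existsNP => H; move: nt; rewrite ltNge => /negP; apply.
    apply: (le_trans (kill_exit H)); rewrite lee_fin.
    rewrite (_ : n%:R * (2 * dwell) = (2 * n)%:R * dwell); last by rewrite natrM; lra.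
    by rewrite ler_pM2r// ler_nat; lia.
  have mono m m' k : (m <= m')%N -> ~ kill m k w -> ~ kill m' k w.
    move=> mm'; rewrite -(subnK mm'); elim: (m' - m)%N => // j IH nk0.
    by rewrite addSn => /killS; exact: IH.
  suff [m Hm] : exists m, forall k, (k < n)%N -> ~ kill m k w by exists m.
  elim: n nk {nt} => [_|n IH nk]; first by exists 0%N.
  have [m1 Hm1] := IH (fun k kn => nk k (ltnW kn)).
  have [m2 Hm2] := nk n (ltnSn n).
  exists (maxn m1 m2) => k; rewrite ltnS leq_eqVlt => /predU1P[->|kn].
    by apply: mono Hm2; exact: leq_maxr.
  by apply: mono (Hm1 k kn); exact: leq_maxl.
Qed.

End killing.

(** * The Brownian-Hardy numbers *)

(** Reflection in the real axis, for starting points below it. *)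
Lemma planar_BM_flip {R : realType} {d : measure_display} {T : measurableType d}
    (P : probability T R) (a : R * R) (X Y : R -> T -> R) :
  planar_BM P a X Y -> planar_BM P (a.1, - a.2) X (fun t w => - Y t w).
Proof.
move=> [mXY B0 cXY law]; split.
- move=> t; have [mX mY] := mXY t; split => //.
  exact: measurable_funN.
- by move=> w /=; have [-> ->] := B0 w.
- move=> w; have [cX cY] := cXY w; split => //.
  by move=> t; apply: cvgN; exact: cY.
- move=> n t A C t0 tl mAC.
  have mAC' i : measurable (A i) /\ measurable (-%R @^-1` (C i) : set R).
    have [mA mC] := mAC i; split => //.
    by rewrite -[X in measurable X]setTI; exact: oppr_measurable.
  have := law n t A (fun i => -%R @^-1` (C i)) t0 tl mAC' => E.
  transitivity (\prod_(i < n) (fine (normal_prob 0 (Num.sqrt (t i.+1 - t i)) (A i)) *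
    fine (normal_prob 0 (Num.sqrt (t i.+1 - t i)) (-%R @^-1` (C i)))))%:E.
    rewrite -E; congr (P _); apply: eq_bigcapr => i _.
    by apply/seteqP; split => w /= [HA HC]; split => //; move: HC; rewrite /preimage /= opprD.
  congr EFin; apply: eq_bigr => i _; congr (_ * fine _).
  have [_ mC] := mAC i; apply: normal_probN mC.
  by rewrite gt_eqF// sqrtr_gt0 subr_gt0 tl.
Qed.

Lemma bh_eq_half {R : realType} {d : measure_display} {T : measurableType d}
    (P : probability T R) (tau : T -> \bar R) :
  (forall p, 0 < p -> p < 1 / 2 -> (\int[P]_w (poweR (tau w) p) < +oo)%E) ->
  (forall p, 1 / 2 < p -> (\int[P]_w (poweR (tau w) p) = +oo)%E) ->
  bh P tau = (1 / 2)%:E.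
Proof.
move=> fin inf; apply/eqP; rewrite eq_le; apply/andP; split.
  apply: ge_ereal_sup => _ [p [p0 pfin] <-]; rewrite lee_fin leNgt.
  by apply/negP => /inf E; move: pfin; rewrite E ltxx.
have sup_ge p : 0 < p -> p < 1 / 2 -> (p%:E <= bh P tau)%E.
  by move=> p0 p2; apply: ereal_sup_ubound; exists p => //; split => //; exact: fin.
rewrite leNgt; apply/negP.
(* The exponent 1/4 excludes -oo and makes the midpoint of s and 1/2 positive. *)
have := sup_ge (1 / 4) ltac:(lra) ltac:(lra).
case: (bh P tau) sup_ge => [s||]//= sup_ge; rewrite lee_fin lte_fin => s4 s2.
have := sup_ge ((s + 1 / 2) / 2) ltac:(lra) ltac:(lra); rewrite lee_fin; lra.
Qed.

Section lower_bounds.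
Context {R : realType} {d : measure_display} {T : measurableType d}.
Context (P : probability T R) (a : R * R) (X Y : R -> T -> R).
Hypothesis BM : planar_BM P a X Y.

(** Stated for any D containing the half-plane, so that it serves both domains. *)
Lemma moment_infinite_above (D : set (R * R)) (p : R) :
  upper_half_plane `<=` D -> 0 < a.2 -> 1 / 2 < p ->
  (\int[P]_w (poweR (exit_time D X Y w) p) = +oo)%E.
Proof.
move=> HD a0 p2; have [c c0 Hc] := upper_survival BM a0.
apply: (moment_infinite c0 ltr01 p2) => n n0; have [S [mS cS HS]] := Hc n n0.
exists S; split => // w Sw; rewrite mulr1; apply: exit_time_ge => u u0 un.
by apply: HD; exact: HS.
Qed.

Lemma moment_infinite_gap (x r p : R) : 0 < r -> r < x ->
  dashed_domain x r a -> a.2 = 0 -> 1 / 2 < p ->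
  (\int[P]_w (poweR (exit_time (dashed_domain x r) X Y w) p) = +oo)%E.
Proof.
move=> r0 rx Da a20 p2; have x0 : 0 < x by lra.
have gap (n : int) : r < `|a.1 - n%:~R * x|.
  by rewrite ltNge; apply/negP => H; apply: Da; split => //; exists n.
(* The gap that contains the starting point lies between the dashes [z] and [z + 1]. *)
pose z := Num.floor (a.1 / x).
have /andP[z1 z2] := floor_itv (a.1 / x); rewrite -/z in z1 z2.
rewrite ler_pdivlMr// in z1; rewrite ltr_pdivrMr// in z2.
have g1 := gap z; have g2 := gap (z + 1).
rewrite ger0_norm in g1; last by rewrite subr_ge0.
rewrite ltr0_norm in g2; last by rewrite subr_lt0.
(* Half of the distance to the nearer end of the gap; the factor 1/2 keeps X strictly inside. *)
pose e := Num.min (a.1 - z%:~R * x - r) (- (a.1 - (z + 1)%:~R * x) - r) / 2.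
have e0 : 0 < e by rewrite /e divr_gt0// lt_min; apply/andP; split; lra.
have e1 : e < a.1 - z%:~R * x - r.
  have : Num.min (a.1 - z%:~R * x - r) (- (a.1 - (z + 1)%:~R * x) - r) <=
    a.1 - z%:~R * x - r by rewrite ge_min lexx.
  by move: e0; rewrite /e; lra.
have e2 : e < - (a.1 - (z + 1)%:~R * x) - r.
  have : Num.min (a.1 - z%:~R * x - r) (- (a.1 - (z + 1)%:~R * x) - r) <=
    - (a.1 - (z + 1)%:~R * x) - r by rewrite ge_min lexx orbT.
  by move: e0; rewrite /e; lra.
have away y (n : int) : `|y - a.1| <= e -> ~ (`|y - n%:~R * x| <= r).
  rewrite !ler_norml => /andP[y1 y2] /andP[n1 n2].
  have [nz|nz] := lerP n z.
    have : n%:~R * x <= z%:~R * x by rewrite ler_pM2r// ler_int.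
    lra.
  have : (z + 1)%:~R * x <= n%:~R * x by rewrite ler_pM2r// ler_int lezD1.
  lra.
have [s [c [s0 c0 Hc]]] := gap_survival BM e0.
apply: (moment_infinite c0 s0 p2) => n n0; have [S [mS cS HS]] := Hc n n0.
exists S; split => // w Sw; have [HX HY] := HS w Sw.
apply: exit_time_ge => u u0 un [/= Yu [k Hk]].
have [us|su] := lerP u s; first by apply: away Hk; exact: HX.
have := HY u (ltW su) ltac:(lra); rewrite a20 Yu ltxx; by [].
Qed.

End lower_bounds.

Theorem theorem3p1 (R : realType) (x r : R) (hr : 0 < r) (hrx : r < x) :
  (forall (d : measure_display) (Omega : measurableType d)
          (P : probability Omega R) (a : R * R) (X Y : R -> Omega -> R),
      dashed_domain x r a -> planar_BM P a X Y ->
      bh P (exit_time (dashed_domain x r) X Y) = (1 / 2)%:E) /\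
  (forall (d : measure_display) (Omega : measurableType d)
          (P : probability Omega R) (a : R * R) (X Y : R -> Omega -> R),
      upper_half_plane a -> planar_BM P a X Y ->
      bh P (exit_time upper_half_plane X Y) = (1 / 2)%:E).
Proof.
have HD : upper_half_plane `<=` dashed_domain x r.
  by move=> z; rewrite /upper_half_plane /= => z0 [z20 _]; rewrite z20 ltxx in z0.
split=> d Omega P a X Y Da BM; apply: bh_eq_half => p.
- by move=> p0 p2; exact: (dashed_moment_finite BM hr hrx p0 p2).
- move=> p2; have [a0|a0|a0] := ltgtP 0 a.2.
  + exact: (moment_infinite_above BM HD a0 p2).
  (* The dashed domain is symmetric in the real axis, so the reflected motion has the same exit
     time. *)
  + have a0' : 0 < (a.1, - a.2).2 by rewrite /= oppr_gt0.
    rewrite -(moment_infinite_above (planar_BM_flip BM) HD a0' p2).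
    apply: eq_integral => w _; congr poweR; rewrite /exit_time; congr ereal_inf.
    congr (image _ _); apply/seteqP; split => t /= [t0 nD]; split => // D1; apply: nD => -[/= h1 h2].
      by apply: D1; split => //=; rewrite h1 oppr0.
    by apply: D1; split => //=; apply/eqP; rewrite -oppr_eq0 h1.
  + exact: (moment_infinite_gap BM hr hrx Da (esym a0) p2).
(* A point outside the dashed domain is outside the half-plane, so the half-plane is left no
   later. *)
- move=> p0 p2; apply: le_lt_trans (dashed_moment_finite BM hr hrx p0 p2).
  apply: le_integral_nonneg => w; first exact: poweR_ge0.
  apply: gt0_ler_poweR; first exact: ltW.
  + by rewrite in_itv/= leey exit_time_ge0.
  + by rewrite in_itv/= leey exit_time_ge0.
  + apply: ereal_inf_le_tmp => _ [t [t0 nD] <-]; exists t => //; split => // Ht.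
    by apply: nD; exact: HD.
- by move=> p2; exact: (moment_infinite_above BM (@subset_refl _ _) Da p2).
Qed.
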